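(* Suppose that $N,X_1,X_2,\dotsc$ are independent random variables on a common probability space, where $N$ takes values in $\mathbb{N}_0$ with $\mathbb{E}[N]>0$ and $\mathbb{E}[N^2]<\infty$, and the real-valued random variables $X_j$, $j\in\mathbb{N}$, are identically distributed with $\mathbb{E}[X_1]=0$ and $0<\mathbb{E}[X_1^4]<\infty$. Let $S:=\sum_{j=1}^{N}X_j=\sum_{j=1}^\infty \mathbf{1}_{\{N\ge j\}}X_j$ and $$F:=\frac{S-\mathbb{E}[S]}{\sqrt{\operatorname{Var}(S)}}=\frac{S}{\sqrt{\mathbb{E}[N]\,\mathbb{E}[X_1^2]}}.$$ Then, for $Z\sim N(0,1)$, $$d_{\mathcal W}(F,Z)\leq\Biggl[\sqrt{\frac{2}{\pi}}\biggl(\frac{\mathbb{E}[X_1^4]}{\mathbb{E}[X_1^2]^2}-1\biggr)^{1/2}+\frac{\mathbb{E}|X_1|^3}{\mathbb{E}[X_1^2]^{3/2}}\Biggr]\frac{1}{\sqrt{\mathbb{E}[N]}}+\frac{\sqrt{\operatorname{Var}(N)}}{\mathbb{E}[N]}.$$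
   Context: The Wasserstein distance between (the distributions of) integrable real random variables $Y,W$ is $d_{\mathcal W}(Y,W)=\sup_h|\mathbb{E}[h(Y)]-\mathbb{E}[h(W)]|$, the supremum being over all Lipschitz functions $h:\mathbb{R}\to\mathbb{R}$ with Lipschitz constant $1$. *)

(* Defs.v *)
From HB Require Import structures.
From mathcomp Require Import all_boot all_order all_algebra finmap.
From mathcomp Require Import all_classical all_reals all_analysis.

Set Implicit Arguments.
Unset Strict Implicit.
Unset Printing Implicit Defensive.

Import Order.TTheory GRing.Theory Num.Theory.
Import numFieldNormedType.Exports.

Local Open Scope classical_set_scope.
Local Open Scope ring_scope.

(* Mutual independence of a family of set systems: the product rule holds on
   every finite subfamily. *)
Definition mutually_independent (d : measure_display) (T : measurableType d)
    (R : realType) (P : probability T R) (I : choiceType)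
    (G : I -> set (set T)) : Prop :=
  forall (J : {fset I}) (A : I -> set T),
    (forall i, i \in J -> G i (A i)) ->
    P (\bigcap_(i in [set` J]) A i) = (\prod_(i <- J) P (A i))%E.

(* The sigma-algebras generated by N (index None) and by the X j (index
   Some j); an option index is used because N and the X j have different
   codomains. *)
Definition sigma_N_X (d : measure_display) (T : measurableType d)
    (R : realType) (P : probability T R)
    (N : {RV P >-> nat}) (X : nat -> {RV P >-> R}) (i : option nat) :
    set (set T) :=
  match i with
  | None => preimage_set_system [set: T] N measurable
  | Some j => preimage_set_system [set: T] (X j) measurable
  end.

(* Y and W may live on different probability spaces. For integrable Y and W,
   every expectation below is finite. *)
Definition wasserstein (R : realType)
    (d : measure_display) (T : measurableType d) (P : probability T R)
    (Y : T -> R)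
    (d' : measure_display) (T' : measurableType d') (Q : probability T' R)
    (W : T' -> R) : \bar R :=
  ereal_sup [set (`| 'E_P[h \o Y] - 'E_Q[h \o W] |)%E |
             h in [set h : R -> R | 1.-lipschitz (h : R^o -> R^o)]].

(* The sequence X_1, X_2, ... is indexed from 0, i.e. X j stands for X_(j+1),
   so that the sum over j < N w is X_1 + ... + X_(N w). *)
Definition random_sum (T : Type) (R : realType) (N : T -> nat)
    (X : nat -> T -> R) (w : T) : R :=
  \sum_(j < N w) X j w.

Definition standardize (d : measure_display) (T : measurableType d)
    (R : realType) (P : probability T R) (Y : T -> R) (w : T) : R :=
  (Y w - fine 'E_P[Y]) / Num.sqrt (fine 'V_P[Y]).

(* Main.v *)
Require Import Defs.
From HB Require Import structures.
From mathcomp Require Import all_boot all_order all_algebra finmap.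
From mathcomp Require Import all_classical all_reals all_analysis.
From mathcomp Require Import measurable_realfun ring lra.

(** The proof is Stein's method with a leave-one-out expansion. Put
    [s = sqrt (E N * m2)] and [F = S / s], let [h] be 1-Lipschitz, and let [f] be
    the bounded solution of Stein's equation [f' x - x * f x = h x - E h(Z)].
    With [Q = \sum_(j < N) (X j / s) ^+ 2], which has mean 1,
    [[
      E h(F) - E h(Z) = E (f' (F) * (1 - Q)) + E (f' (F) * Q - F * f (F)).
    ]]

    Second term. In [E (F * f (F))] one may replace [X j / s * f (F)] by
    [X j / s * (f (F) - f (F_j))], where [F_j] omits the [j]-th summand, since
    [X j] is centred and independent of [N] and the other summands. As [f'] is
    2-Lipschitz ([stein'_lipschitz]), Taylor's formula ([stein_taylor]) compares
    this with [(X j / s) ^+ 2 * f' (F)] at the cost of [(`|X j| / s) ^+ 3] per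
    summand, that is [E N * m3 / s ^+ 3 = m3 / (m2 `^ (3 / 2) * sqrt (E N))] in
    total ([stein_random_sum]).

    First term. [`|f'| <= sqrt (2 / pi)] ([stein'_le]), and [1 - Q] is the sum of
    [(E N - N) / E N] and of a random sum of the independent centred variables
    [(1 - X j ^+ 2 / m2) / E N]. By the Cauchy-Schwarz inequality and Wald's
    second identity ([wald2]) their first absolute moments are at most
    [sqrt (Var N) / E N] and [sqrt (m4 / m2 ^+ 2 - 1) / sqrt (E N)].

    As [f'] is [x * f + h] up to a constant, its Lipschitz bound comes from one
    on [(x * f)']. No derivative of [h] is used: the value at [x] of [f],
    of [f'] and of [(x * f)'] is a linear function of the two partial integrals
    of [(h t - h x) * phi t] over [t <= x] and [t >= x], which are at most
    [E (x - Z)^+] and [E (Z - x)^+] in absolute value. The coefficients have a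
    fixed sign by Mills' inequality ([mills]), so that everything reduces to an
    identity for [(x * f)'] and, for [f'], to the inequality
    [E (x - Z)^+ * E (Z - x)^+ <= phi x * phi 0] ([mean_shortfall_excess_le]).

    Independence is used through two facts: mutual independence passes from
    the generating events to the generated sigma-algebras
    ([indep_sigma_cylinders]), and the expectation of a product of independent
    variables factors ([Rintegral_indep_mul]). All computations are made on the
    events [N = n] and summed by [integral_levelwise_le]. *)

Set Implicit Arguments.
Unset Strict Implicit.
Unset Printing Implicit Defensive.

Import Order.TTheory GRing.Theory Num.Theory.
Import numFieldNormedType.Exports.

Local Open Scope classical_set_scope.
Local Open Scope ring_scope.

(** * The Gaussian density, distribution function and partial means *)

Section Calculus.
Context {R : realType}.
Implicit Types x y : R.

Lemma nonincreasing_of_derive (f df : R -> R) (a : R) :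
  (forall x, a <= x -> is_derive x 1 f (df x)) ->
  (forall x, a <= x -> df x <= 0) ->
  forall x y, a <= x -> x <= y -> f y <= f x.
Proof.
move=> Df df0 x y ax xy.
have [||c cxy E] := @MVT_segment R f df x y xy.
- by move=> z /[!in_itv]/= /andP[xz _]; apply: Df; lra.
- apply: derivable_within_continuous => z /[!in_itv]/= /andP[xz _].
  by have [] := Df z (le_trans ax xz).
- rewrite -subr_le0 E mulr_le0_ge0 ?subr_ge0//; apply: df0.
  by move: cxy; rewrite in_itv/= => /andP[/(le_trans ax)].
Qed.

Lemma derivable1_cvg (f : R -> R) x :
  derivable f x 1 -> f y @[y --> x] --> f x.
Proof. by move=> Df; exact/differentiable_continuous/derivable1_diffP. Qed.

Local Notation phi := (normal_pdf (0 : R) 1).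

Lemma phiE x : phi x = phi 0 * expR (- x ^+ 2 / 2).
Proof.
rewrite normal_pdfE ?oner_eq0// /normal_fun.
by rewrite !subr0 !expr1n expr0n/= oppr0 mul0r expR0 mulr1.
Qed.

Lemma phi0E : phi 0 = (Num.sqrt (2 * pi))^-1.
Proof.
rewrite normal_pdfE ?oner_eq0// /normal_fun /normal_peak.
by rewrite subrr expr0n/= oppr0 mul0r expR0 mulr1 expr1n mul1r mulr_natl.
Qed.

Lemma phi_gt0 x : 0 < phi x.
Proof.
rewrite phiE phi0E mulr_gt0 ?expR_gt0// invr_gt0 sqrtr_gt0.
by rewrite mulr_gt0// pi_gt0.
Qed.

Lemma phiN x : phi (- x) = phi x.
Proof. by rewrite phiE sqrrN -phiE. Qed.

Lemma is_derive_phi x : is_derive x 1 phi (- x * phi x).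
Proof.
have -> : (phi : R -> R) = (fun y => phi 0 * expR (- y ^+ 2 / 2)).
  by apply/funext => y; rewrite phiE.
apply: is_derive_eq.
by rewrite /GRing.scale/=; field.
Qed.

Lemma phi_le0 x : phi x <= phi 0.
Proof.
rewrite phiE ger_pMr ?phi_gt0// -[leRHS]expR0 ler_expR.
by have := sqr_ge0 x; lra.
Qed.

Lemma phi_le_inv x : x != 0 -> phi x <= 2 * phi 0 / x ^+ 2.
Proof.
move=> x0.
have x2 : 0 < x ^+ 2 by rewrite exprn_even_gt0.
rewrite phiE -mulrA mulrCA ler_pM2l ?phi_gt0// mulNr expRN.
rewrite invf_ple ?posrE ?expR_gt0 ?divr_gt0// invf_div.
by apply: le_trans (expR_ge1Dx _); lra.
Qed.

Lemma cvg_phi : phi x @[x --> +oo] --> 0.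
Proof.
apply: (@squeeze_cvgr _ _ _ _ (cst 0) (fun x => 2 * phi 0 * x^-1)).
- near=> x; rewrite /cst ltW ?phi_gt0//=.
  have x1 : 1 <= x by near: x; exact: nbhs_pinfty_ge.
  have x0 : 0 < x by lra.
  rewrite (le_trans (phi_le_inv _)) ?gt_eqF// ler_pM2l; last first.
    by rewrite mulr_gt0 ?phi_gt0.
  by rewrite lef_pV2 ?posrE ?exprn_gt0// expr2 ler_peMl// ltW.
- exact: cvg_cst.
- rewrite -[X in _ --> X](mulr0 (2 * phi 0)); apply: cvgM; first exact: cvg_cst.
  by apply/gtr0_cvgV0; [exact: nbhs_pinfty_gt|exact: cvg_id].
Unshelve. all: by end_near. Qed.

Lemma two_phi0 : 2 * phi 0 = Num.sqrt (2 / pi).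
Proof.
have p0 : 0 < pi :> R := pi_gt0 R.
rewrite phi0E -[LHS]ger0_norm ?divr_ge0 ?sqrtr_ge0// -sqrtr_sqr.
rewrite exprMn exprVn sqr_sqrtr ?mulr_ge0 ?ltW//; congr Num.sqrt.
by move: (@pi R) p0 => p p0; field; exact: lt0r_neq0 p0.
Qed.

Local Notation mu := (@lebesgue_measure R).
Local Notation gauss := (@normal_prob R 0 1).

Definition Phi x := fine (gauss `]-oo, x]).

Lemma gaussE (A : set R) : gauss A = (\int[mu]_(t in A) (phi t)%:E)%E.
Proof. by []. Qed.

Lemma Phi_ge0 x : 0 <= Phi x.
Proof. exact: fine_ge0. Qed.

Lemma Phi_le1 x : Phi x <= 1.
Proof. by rewrite -lee_fin fineK ?fin_num_measure//; exact: probability_le1. Qed.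

Lemma continuous_phi : continuous phi.
Proof. by apply: continuous_normal_pdf; rewrite oner_eq0. Qed.

Lemma is_derive_Phi x : is_derive x 1 Phi (phi x).
Proof.
have intphi : mu.-integrable `]-oo, (x + 1)] (EFin \o phi).
  by apply: integrableS (integrable_normal_pdf 0 1).
have [] := @continuous_FTC1 R phi -oo%O x (x + 1) _ intphi.
- by rewrite ltrDl.
- by rewrite ltNyr.
- exact: continuous_phi.
- move=> dPhi <-; rewrite derive1E; exact/derivableP.
Qed.

Let idTR : measurableTypeR R -> R := idfun.

#[local] HB.instance Definition _ :=
  @isMeasurableFun.Build _ _ _ _ idTR (@measurable_id _ _ setT).

Lemma cvg_Phi : Phi x @[x --> +oo] --> (1 : R).
Proof.
have := @cvg_cdfy1 _ _ R gauss (idTR : {RV gauss >-> R}).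
exact: fine_cvg.
Qed.

Lemma PhiN x : Phi (- x) = 1 - Phi x.
Proof.
rewrite /Phi gaussE ge0_integration_by_substitutionNy; last 2 first.
- by apply: continuous_subspaceT; exact: continuous_phi.
- by move=> t _; exact: normal_pdf_ge0.
under eq_integral do rewrite /= phiN.
rewrite -integral_itv_obnd_cbnd; last first.
  by apply/measurable_EFinP/measurable_funTS; exact: measurable_normal_pdf.
by rewrite -gaussE -setCitvl probability_setC// fineB ?fin_num_measure.
Qed.

(** The partial means [E (Z - x)^+] and [E (x - Z)^+] of a standard normal
    variable [Z], in closed form. *)
Definition mean_excess x := phi x - x * (1 - Phi x).
Definition mean_shortfall x := phi x + x * Phi x.

(** Since [phi' t = - t * phi t], the integrand has the primitive
    [- phi t - x * Phi t]. *)
Lemma integral_mean_excess x :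
  (\int[mu]_(t in `[x, +oo[) ((t - x) * phi t)%:E = (mean_excess x)%:E)%E.
Proof.
rewrite /mean_excess.
rewrite (@ge0_continuous_FTC2y R _ (fun t => - phi t - x * Phi t) x (- x)).
- by rewrite -EFinD; congr EFin; ring.
- by move=> t xt; rewrite mulr_ge0 ?subr_ge0// normal_pdf_ge0.
- apply: continuous_subspaceT => t; apply: cvgM; last exact: continuous_phi.
  by apply: cvgB => //; exact: cvg_cst.
- rewrite -[X in _ --> X]add0r -[in X in _ --> X]oppr0; apply: cvgB.
    by apply: cvgN; exact: cvg_phi.
  rewrite -[X in _ --> X]mulr1; apply: cvgM; first exact: cvg_cst.
  exact: cvg_Phi.
- move=> t _; have := is_derive_phi t; have := is_derive_Phi t => ? ?.
  exact: ex_derive.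
- apply: cvg_at_right_filter.
  have := is_derive_phi x; have := is_derive_Phi x => ? ?.
  apply: derivable1_cvg; exact: ex_derive.
- move=> t _ /=; rewrite derive1E.
  have := is_derive_phi t; have := is_derive_Phi t => ? ?.
  by rewrite derive_val /GRing.scale/=; ring.
Qed.

Lemma mean_shortfallN x : mean_shortfall (- x) = mean_excess x.
Proof. by rewrite /mean_shortfall /mean_excess phiN PhiN; ring. Qed.

Lemma integral_mean_shortfall x :
  (\int[mu]_(t in `]-oo, x]) ((x - t) * phi t)%:E = (mean_shortfall x)%:E)%E.
Proof.
rewrite -[in RHS](opprK x) mean_shortfallN -integral_mean_excess.
rewrite -{1 2}(opprK x) ge0_integration_by_substitutionNy; last 2 first.
- apply: continuous_subspaceT => t; apply: cvgM; last exact: continuous_phi.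
  by apply: cvgB => //; exact: cvg_cst.
- move=> t; rewrite opprK in_itv/= => tx.
  by rewrite mulr_ge0 ?normal_pdf_ge0// subr_ge0 ltW.
by apply: eq_integral => t _; rewrite /= phiN !opprK addrC.
Qed.

Lemma mean_excess_ge0 x : 0 <= mean_excess x.
Proof.
rewrite -lee_fin -integral_mean_excess integral_ge0// => t.
by rewrite /= in_itv/= andbT => xt; rewrite lee_fin mulr_ge0 ?subr_ge0// normal_pdf_ge0.
Qed.

Lemma mean_shortfall_ge0 x : 0 <= mean_shortfall x.
Proof. by rewrite -(opprK x) mean_shortfallN mean_excess_ge0. Qed.

(** Stands in for a limit at infinity: it applies when [g] is the value at one
    point of a nonincreasing function that is at least [- (c / y)] at every
    large [y]. *)
Lemma ge0_of_inv_bound (c g a : R) : 0 <= c ->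
  (forall y, 0 < y -> a <= y -> - (c / y) <= g) -> 0 <= g.
Proof.
move=> c0 H; rewrite leNgt; apply/negP => g0.
pose y := Num.max 1 (Num.max a ((c + 1) / - g)).
have y1 : 1 <= y by rewrite le_max lexx.
have ya : a <= y by rewrite !le_max lexx orbT.
have yc : (c + 1) / - g <= y by rewrite !le_max lexx !orbT.
have y0 : 0 < y by lra.
have := H y y0 ya; rewrite lerNl ler_pdivlMr//.
by move: yc; rewrite ler_pdivrMr; nra.
Qed.

(** The derivative of the right-hand side minus the left-hand side is
    [- 2 * mean_excess], so this difference is nonincreasing; it vanishes at
    infinity. *)
Lemma mills x : x * phi x <= (1 + x ^+ 2) * (1 - Phi x).
Proof.
rewrite -subr_ge0.
pose W y := (1 + y ^+ 2) * (1 - Phi y) - y * phi y.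
apply: (@ge0_of_inv_bound (2 * phi 0) (W x) x) => [|y y0 xy].
  by rewrite mulr_ge0 ?normal_pdf_ge0.
have Wy : W y <= W x.
  apply: (@nonincreasing_of_derive W (fun t => - (2 * mean_excess t)) x) => //.
  - move=> t _; have := is_derive_phi t; have := is_derive_Phi t => ? ?.
    apply: is_derive_eq; rewrite /mean_excess /GRing.scale/=; ring.
  - by move=> t _; have := mean_excess_ge0 t; lra.
apply: le_trans Wy; rewrite /W.
have : y * phi y <= 2 * phi 0 / y.
  rewrite (le_trans (ler_wpM2l (ltW y0) (phi_le_inv _)))// ?gt_eqF//.
  by rewrite le_eqVlt; apply/orP; left; apply/eqP; field; rewrite gt_eqF.
have : 0 <= (1 + y ^+ 2) * (1 - Phi y).
  by rewrite mulr_ge0 ?subr_ge0 ?Phi_le1// addr_ge0// sqr_ge0.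
by lra.
Qed.

Lemma millsN x : 0 <= (1 + x ^+ 2) * Phi x + x * phi x.
Proof.
by have := mills (- x); rewrite phiN PhiN sqrrN; lra.
Qed.

Lemma Phi0 : Phi 0 = 2^-1.
Proof. by have := PhiN 0; rewrite oppr0; lra. Qed.

(** [Phi] is concave on the positive half-line. *)
Lemma Phi_le_tangent x : 0 <= x -> Phi x <= 2^-1 + phi 0 * x.
Proof.
move=> x0; rewrite -Phi0 -subr_le0.
have := @nonincreasing_of_derive (fun t => Phi t - phi 0 * t)
  (fun t => phi t - phi 0) 0.
move=> /(_ _ _ 0 x (lexx _) x0); rewrite mulr0 subr0 => H.
suff: Phi x - phi 0 * x <= Phi 0 by lra.
apply: H => t _.
- have := is_derive_Phi t => ?.
  by apply: is_derive_eq; rewrite /GRing.scale/=; ring.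
- by rewrite subr_le0 phi_le0.
Qed.

(** Equality holds at [x = 0]; this is the inequality that produces the constant
    [sqrt (2 / pi)] in the bound on the derivative of the Stein solution. Both
    sides are even in [x]. For [x > 0] the difference [G] of the two sides
    satisfies [(G / x^2)' = phi * V / x^3], where [V] vanishes at 0 and
    [V' = 2 * (Phi - 1 / 2 - phi 0 * x)] is nonpositive by concavity. Hence
    [G / x^2] is nonincreasing, and it is at least [- phi 0 / x]. *)
Lemma mean_shortfall_excess_le x : mean_shortfall x * mean_excess x <= phi x * phi 0.
Proof.
wlog x0 : x / 0 < x.
  move=> H; have [x0|x0|->] := ltgtP x 0; [|exact: H|].
  - have := H (- x); rewrite oppr_gt0 => /(_ x0).
    by rewrite mean_shortfallN phiN mulrC -[in mean_excess _]mean_shortfallN opprK.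
  - by rewrite /mean_shortfall /mean_excess !mul0r addr0 subr0.
pose V t := 2 * (Phi t - 2^-1) * t - phi 0 * t ^+ 2 - 2 * phi 0 + 2 * phi t.
have V_le0 t : 0 <= t -> V t <= 0.
  move=> t0; have -> : 0 = V 0 by rewrite /V Phi0; ring.
  apply: (@nonincreasing_of_derive V
    (fun y => 2 * (Phi y - 2^-1 - phi 0 * y)) 0) => // y y0.
  - have := is_derive_phi y; have := is_derive_Phi y => ? ?.
    by apply: is_derive_eq; rewrite /GRing.scale/=; field.
  - by have := Phi_le_tangent y0; lra.
pose G t := phi t * phi 0 - mean_shortfall t * mean_excess t.
suff : 0 <= G x / x ^+ 2.
  by rewrite pmulr_lge0 ?invr_gt0 ?exprn_gt0// subr_ge0.
apply: (@ge0_of_inv_bound (phi 0) _ x) => [|y y0 xy].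
  exact: normal_pdf_ge0.
have GV : G y / y ^+ 2 <= G x / x ^+ 2.
  apply: (@nonincreasing_of_derive (fun t => G t / t ^+ 2)
    (fun t => phi t * V t / t ^+ 3) x) => // t xt.
  - have t0 : t != 0 by rewrite gt_eqF//; lra.
    have t20 : t ^+ 2 != 0 by rewrite expf_neq0.
    have := is_derive_phi t; have := is_derive_Phi t => ? ?.
    have ? : is_derive t 1 (fun y : R => (y ^+ 2)^-1) (- 2 / t ^+ 3).
      split; first by apply: derivableV => //; exact: ex_derive.
      rewrite deriveV// derive_val /GRing.scale/=; field; exact: t0.
    rewrite /G /mean_shortfall /mean_excess.
    apply: is_derive_eq; rewrite /GRing.scale/= /V; field.
    exact: t0.
  - rewrite mulr_le0_ge0 ?invr_ge0 ?exprn_ge0//; last lra.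
    by rewrite mulr_ge0_le0 ?normal_pdf_ge0// V_le0//; lra.
apply: le_trans GV.
rewrite ler_pdivlMr ?exprn_gt0// /G /mean_shortfall /mean_excess.
have -> : - (phi 0 / y) * y ^+ 2 = - (y * phi 0) by field; rewrite gt_eqF.
have := Phi_le1 y; have := Phi_ge0 y; have := phi_le0 y; have := phi_gt0 y.
(* With phi y = a, phi 0 = b and Phi y = c, the claim is a nonnegative
   combination of the four products that follow. *)
move: (phi y) (phi 0) (Phi y) => a b c a0 ab c0 c1.
have : 0 <= a * (b - a) by rewrite mulr_ge0 ?subr_ge0// ltW.
have : 0 <= y ^+ 2 * (c * (1 - c)).
  by rewrite mulr_ge0 ?sqr_ge0// mulr_ge0// subr_ge0.
have : 0 <= y * (b - a) by rewrite mulr_ge0 ?subr_ge0// ltW.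
have : 0 <= y * a * (1 - c) by rewrite mulr_ge0 ?subr_ge0// mulr_ge0// ltW.
by nra.
Qed.

End Calculus.

(** * Consequences of bounds on a derivative *)

Section Derivative.
Context {R : realType}.

Lemma lipschitz_of_derive (f df : R -> R) (k : R) :
  (forall x : R, is_derive x 1 f (df x)) -> (forall x, `|df x| <= k) ->
  forall x y, `|f x - f y| <= k * `|x - y|.
Proof.
move=> Df dfk x y.
wlog xy : x y / y <= x.
  by move=> H; have [/H//|/ltW/H] := leP y x; rewrite distrC (distrC y).
have [|c _ ->] := @MVT_segment R f df y x xy (fun z _ => Df z).
  by apply: derivable_within_continuous => z _; have [] := Df z.
by rewrite normrM ler_wpM2r.
Qed.

Lemma max_of_derive (f df : R -> R) x :
  (forall t : R, is_derive t 1 f (df t)) ->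
  (forall t, df t * (t - x) <= 0) -> forall y, f y <= f x.
Proof.
move=> Df df0 y.
have cf a b : {within `[a, b], continuous f}.
  by apply: derivable_within_continuous => z _; have [] := Df z.
have [xy|yx|->//] := ltgtP x y.
- have [c] := MVT xy (fun z _ => Df z) (cf _ _).
  rewrite in_itv/= => /andP[xc cy] E; rewrite -subr_le0 E.
  have := df0 c; rewrite pmulr_lle0 ?subr_gt0// => ?.
  by rewrite mulr_le0_ge0// subr_ge0 ltW.
- have [c] := MVT yx (fun z _ => Df z) (cf _ _).
  rewrite in_itv/= => /andP[yc cx] E; rewrite -subr_ge0 E.
  have := df0 c; rewrite nmulr_lle0 ?subr_lt0// => ?.
  by rewrite mulr_ge0// subr_ge0 ltW.
Qed.

(** A remainder bound [2 * k * (y - x) ^+ 2] would follow from the mean value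
    theorem for [f]. The factor 2 is gained by comparing with a parabola:
    [f t - t * df x - k * (t - x) ^+ 2] has its maximum at [x], as does the
    corresponding function for [- f]. *)
Lemma taylor1_of_derive_lipschitz (f df : R -> R) (k : R) :
  (forall x : R, is_derive x 1 f (df x)) ->
  (forall x y, `|df x - df y| <= 2 * k * `|x - y|) ->
  forall x y, `|f y - f x - (y - x) * df x| <= k * (y - x) ^+ 2.
Proof.
move=> Df dfk x y.
have H t : `|(df t - df x) * (t - x)| <= 2 * k * (t - x) ^+ 2.
  by rewrite normrM -(real_normK (num_real (t - x))) expr2 mulrA ler_wpM2r.
rewrite ler_norml; apply/andP; split.
- have := @max_of_derive (fun t => - f t + t * df x - k * (t - x) ^+ 2)
    (fun t => - df t + df x - 2 * k * (t - x)) x.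
  move=> /(_ _ _ y); rewrite subrr expr0n/= mulr0 subr0 => G.
  suff : - f y + y * df x - k * (y - x) ^+ 2 <= - f x + x * df x by lra.
  apply: G => t.
  + by have := Df t => ?; apply: is_derive_eq; rewrite /GRing.scale/=; ring.
  + by have := H t; rewrite ler_norml => /andP[+ _]; lra.
- have := @max_of_derive (fun t => f t - t * df x - k * (t - x) ^+ 2)
    (fun t => df t - df x - 2 * k * (t - x)) x.
  move=> /(_ _ _ y); rewrite subrr expr0n/= mulr0 subr0 => G.
  suff : f y - y * df x - k * (y - x) ^+ 2 <= f x - x * df x by lra.
  apply: G => t.
  + by have := Df t => ?; apply: is_derive_eq; rewrite /GRing.scale/=; ring.
  + by have := H t; rewrite ler_norml => /andP[_]; lra.
Qed.

End Derivative.

(** * The solution of Stein's equation *)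

Section Stein.
Context {R : realType}.
Implicit Types x y : R.
Local Notation phi := (normal_pdf (0 : R) 1).
Local Notation mu := (@lebesgue_measure R).

Lemma integrable_norm_phi : mu.-integrable setT (fun t => (`|t| * phi t)%:E).
Proof.
have mphi : measurable_fun setT (fun t : R => `|t| * phi t).
  by apply: measurable_funM; [exact: normr_measurable|exact: measurable_normal_pdf].
apply/integrableP; split; first exact/measurable_EFinP.
under eq_integral => t _ do rewrite /= ger0_norm ?mulr_ge0 ?normal_pdf_ge0//.
rewrite -(setUv `]-oo, (0:R)]%classic) setCitvl ge0_integral_setU//=; last 3 first.
- by apply/measurable_EFinP/measurable_funTS.
- by move=> t _; rewrite lee_fin mulr_ge0 ?normal_pdf_ge0.
- by rewrite -setCitvl; apply/disj_setPCl.
rewrite integral_itv_obnd_cbnd; last exact/measurable_EFinP/measurable_funTS.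
apply: lte_add_pinfty.
- under eq_integral => t.
    rewrite inE/= in_itv/= => t0; rewrite ler0_norm// -[- t]add0r.
    over.
  by rewrite integral_mean_shortfall ltry.
- under eq_integral => t.
    rewrite inE/= in_itv/= andbT => t0; rewrite ger0_norm// -[t in t * _]subr0.
    over.
  by rewrite integral_mean_excess ltry.
Qed.

Context (h : R -> R).
Hypothesis hlip : forall x y, `|h x - h y| <= `|x - y|.

Lemma lipschitz_continuous : continuous h.
Proof.
move=> x; apply/cvgrPdist_lt => e e0; near=> t.
by rewrite (le_lt_trans (hlip _ _))//; near: t; exists e.
Unshelve. all: by end_near. Qed.

Lemma integrable_shift_phi (A : set R) c : measurable A ->
  mu.-integrable A (fun t => ((h t - c) * phi t)%:E).
Proof.
move=> mA; apply: (@integrableS _ _ _ _ setT) => //.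
have mhphi : measurable_fun setT (fun t => (h t - c) * phi t).
  apply: measurable_funM; last exact: measurable_normal_pdf.
  apply: measurable_funB => //.
  exact: continuous_measurable_fun lipschitz_continuous.
have : mu.-integrable setT
    (fun t => (`|h 0 - c|)%:E * (phi t)%:E + (`|t| * phi t)%:E)%E.
  apply: integrableD => //; last exact: integrable_norm_phi.
  by apply: integrableZl => //; exact: integrable_normal_pdf.
apply: le_integrable => //.
- exact/measurable_EFinP.
- move=> t _ /=; rewrite lee_fin normrM (ger0_norm (normal_pdf_ge0 _ _ _)).
  rewrite [leRHS]ger0_norm; last first.
    by rewrite addr_ge0// mulr_ge0// normal_pdf_ge0.
  rewrite -mulrDl ler_wpM2r ?normal_pdf_ge0//.
  have -> : h t - c = (h 0 - c) + (h t - h 0) by ring.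
  by rewrite (le_trans (ler_normD _ _))// lerD2l (le_trans (hlip _ _))// subr0.
Qed.

Definition gauss_mean := \int[mu]_t (h t * phi t).

(** The bounded solution [f] of Stein's equation
    [f' x - x * f x = h x - E h(Z)]. The function [stein'] is [f'] as the
    equation prescribes it. *)
Definition stein x :=
  (\int[mu]_(t in `]-oo, x]) ((h t - gauss_mean) * phi t)) / phi x.

Definition stein' x := x * stein x + (h x - gauss_mean).

Lemma is_derive_stein x : is_derive x 1 stein (stein' x).
Proof.
pose N x := \int[mu]_(t in `]-oo, x]) ((h t - gauss_mean) * phi t).
have ? : is_derive x 1 N ((h x - gauss_mean) * phi x).
  have [] := @continuous_FTC1 R (fun t => (h t - gauss_mean) * phi t) -oo%O x
    (x + 1) _ (integrable_shift_phi _ _).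
  - by rewrite ltrDl.
  - exact: measurable_itv.
  - by rewrite ltNyr.
  - apply: cvgM; last exact: continuous_phi.
    by apply: cvgB; [exact: lipschitz_continuous|exact: cvg_cst].
  - by move=> dN <-; rewrite derive1E; exact/derivableP.
have p0 : phi x != 0 by rewrite gt_eqF ?phi_gt0.
have Dphi := is_derive_phi x.
have ? : is_derive x 1 (fun y => (phi y)^-1) (x / phi x).
  split; first by apply: derivableV => //; exact: ex_derive.
  by rewrite deriveV// derive_val /GRing.scale/=; field.
rewrite /stein; apply: is_derive_eq; rewrite /stein' /stein -/(N x).
by rewrite /GRing.scale/=; field.
Qed.

(** [lo] and [up] are the contributions of the two sides of [x] to
    [E h(Z) - h x]. As [h] is 1-Lipschitz, they are at most the two partial
    means at [x] in absolute value, with equality when [h] is affine of slope 1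
    or -1 on the side in question. Below, [phi x] times [stein x], [stein' x]
    and the derivative of [x * stein x] are written as linear combinations of
    [lo x] and [up x] with coefficients of known sign. *)
Let lo x := \int[mu]_(t in `]-oo, x]) ((h t - h x) * phi t).
Let up x := \int[mu]_(t in `[x, +oo[) ((h t - h x) * phi t).

Let lo_le x : `|lo x| <= mean_shortfall x.
Proof.
have ih := integrable_shift_phi (h x) (measurable_itv `]-oo, x]).
rewrite -lee_fin EFin_normr_Rintegral//.
have mh := measurable_int _ ih.
apply: (le_trans (le_abse_integral _ _ mh)) => //.
rewrite -integral_mean_shortfall; apply: ge0_le_integral => //.
- exact: measurableT_comp.
- apply/measurable_EFinP/measurable_funTS; apply: measurable_funM.
    exact: measurable_funB.
  exact: measurable_normal_pdf.
- move=> t; rewrite /= in_itv/= => tx; rewrite lee_fin normrM.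
  rewrite (ger0_norm (normal_pdf_ge0 _ _ _)) ler_wpM2r ?normal_pdf_ge0//.
  by rewrite (le_trans (hlip _ _))// distrC ger0_norm// subr_ge0.
Qed.

Let up_le x : `|up x| <= mean_excess x.
Proof.
have ih := integrable_shift_phi (h x) (measurable_itv `[x, +oo[).
rewrite -lee_fin EFin_normr_Rintegral//.
have mh := measurable_int _ ih.
apply: (le_trans (le_abse_integral _ _ mh)) => //.
rewrite -integral_mean_excess; apply: ge0_le_integral => //.
- exact: measurableT_comp.
- apply/measurable_EFinP/measurable_funTS; apply: measurable_funM.
    exact: measurable_funB.
  exact: measurable_normal_pdf.
- move=> t; rewrite /= in_itv/= andbT => tx; rewrite lee_fin normrM.
  rewrite (ger0_norm (normal_pdf_ge0 _ _ _)) ler_wpM2r ?normal_pdf_ge0//.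
  by rewrite (le_trans (hlip _ _))// ger0_norm// subr_ge0.
Qed.

Let iphi (A : set R) : measurable A -> mu.-integrable A (EFin \o phi).
Proof.
by move=> mA; apply: (@integrableS _ _ _ _ setT) => //; exact: integrable_normal_pdf.
Qed.

Let shift_phi (A : set R) c d : measurable A ->
  \int[mu]_(t in A) ((h t - c) * phi t) =
  \int[mu]_(t in A) ((h t - d) * phi t) + (d - c) * fine (normal_prob 0 1 A).
Proof.
move=> mA; rewrite gaussE -[fine _]/(\int[mu]_(t in A) phi t).
rewrite -(@RintegralZl _ _ _ mu A phi)//; last exact: iphi.
rewrite -RintegralD//.
- by apply: eq_Rintegral => t _; ring.
- exact: integrable_shift_phi.
- rewrite (_ : _ \o _ = fun t => ((d - c)%:E * (phi t)%:E)%E)//.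
  by apply: integrableZl => //; exact: iphi.
Qed.

Let mean_split x : gauss_mean - h x = lo x + up x.
Proof.
have -> : gauss_mean - h x = \int[mu]_t ((h t - h x) * phi t).
  rewrite (@shift_phi setT (h x) 0)// probability_setT mulr1 sub0r.
  by congr (_ - _); apply: eq_Rintegral => t _; rewrite subr0.
rewrite -(setUv `]-oo, x]%classic) setCitvl Rintegral_setU//.
- rewrite /up Rintegral_itv_obnd_cbnd//; apply: integrable_shift_phi.
  exact: measurable_itv.
- rewrite -setCitvl setUv; exact: integrable_shift_phi.
- by rewrite -setCitvl; apply/disj_setPCl.
Qed.

Let steinE x : phi x * stein x = lo x * (1 - Phi x) - up x * Phi x.
Proof.
rewrite /stein mulrCA divff ?mulr1 ?gt_eqF ?phi_gt0//.
rewrite (@shift_phi _ gauss_mean (h x))// -/(lo x) -/(Phi x).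
by rewrite -[h x - _]opprB mean_split; ring.
Qed.

Let lin_bound (a b p q c d : R) : `|a| <= p -> `|b| <= q -> 0 <= c -> 0 <= d ->
  `|a * c - b * d| <= p * c + q * d.
Proof.
move=> ap bq c0 d0; rewrite (le_trans (ler_normB _ _))// !normrM.
by rewrite (ger0_norm c0) (ger0_norm d0) lerD// ler_wpM2r.
Qed.

Let phi_norm_le (x a b : R) : `|phi x * a| <= phi x * b -> `|a| <= b.
Proof.
by rewrite normrM (ger0_norm (normal_pdf_ge0 _ _ _)) ler_pM2l// phi_gt0.
Qed.

Lemma stein_le1 x : `|stein x| <= 1.
Proof.
apply: (@phi_norm_le x); rewrite steinE.
apply: (le_trans (lin_bound (lo_le x) (up_le x) _ _)).
- by rewrite subr_ge0 Phi_le1.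
- exact: Phi_ge0.
- by rewrite /mean_shortfall /mean_excess; lra.
Qed.

Let stein'E x : phi x * stein' x = (- lo x) * mean_excess x - up x * mean_shortfall x.
Proof.
rewrite /stein' mulrDr mulrCA steinE -[h x - _]opprB mean_split.
by rewrite /mean_excess /mean_shortfall; ring.
Qed.

(** The extreme case is [h t = `|t - x|], for which [phi x * stein' x] is minus
    twice the product of the two partial means. *)
Lemma stein'_le x : `|stein' x| <= 2 * phi 0.
Proof.
apply: (@phi_norm_le x); rewrite stein'E.
apply: (le_trans (lin_bound _ (up_le x) _ _)).
- by rewrite normrN; exact: lo_le.
- exact: mean_excess_ge0.
- exact: mean_shortfall_ge0.
- by have := mean_shortfall_excess_le x; lra.
Qed.

(** [stein'] differs from [x * stein x] by [h] and a constant, and [x * stein x]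
    is itself 1-Lipschitz: in its derivative the coefficients of [lo] and [up]
    have the signs given by Mills' inequality, so the extreme case is
    [h t = t], for which [stein] is the constant -1. *)
Lemma stein'_lipschitz x y : `|stein' x - stein' y| <= 2 * 1 * `|x - y|.
Proof.
have Df (z : R) : is_derive z 1 (fun t : R => t * stein t) (stein z + z * stein' z).
  have := is_derive_stein z => ?.
  by apply: is_derive_eq; rewrite /GRing.scale/=; ring.
have df_le1 z : `|stein z + z * stein' z| <= 1.
  apply: (@phi_norm_le z); rewrite mulrDr [phi z * (z * _)]mulrCA steinE stein'E.
  have := lin_bound (lo_le z) (up_le z) _ (millsN z).
  have := mills z; rewrite -subr_ge0 => m1 /(_ _ m1) H.
  rewrite (_ : lo z * _ - _ + _ =
      lo z * ((1 + z ^+ 2) * (1 - Phi z) - z * phi z)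
    - up z * ((1 + z ^+ 2) * Phi z + z * phi z)); last first.
    by rewrite /mean_excess /mean_shortfall; ring.
  rewrite (le_trans H)// le_eqVlt; apply/orP; left; apply/eqP.
  by rewrite /mean_excess /mean_shortfall; ring.
have := lipschitz_of_derive Df df_le1 x y; have := hlip x y; rewrite /stein'.
move=> h1 h2.
have -> : x * stein x + (h x - gauss_mean) - (y * stein y + (h y - gauss_mean))
  = (x * stein x - y * stein y) + (h x - h y) by ring.
by rewrite (le_trans (ler_normD _ _))//; lra.
Qed.

Lemma stein_taylor x y : `|stein y - stein x - (y - x) * stein' x| <= (y - x) ^+ 2.
Proof.
rewrite -[leRHS]mul1r.
exact: (taylor1_of_derive_lipschitz is_derive_stein stein'_lipschitz).
Qed.

End Stein.

(** * Expectations of Lipschitz functions of a normal variable *)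

Section NormalExpectation.
Context {R : realType}.
Local Notation phi := (normal_pdf (0 : R) 1).
Local Notation mu := (@lebesgue_measure R).
Local Notation gauss := (@normal_prob R 0 1).

(** [phi] is a version of the Radon-Nikodym derivative of the normal
    distribution. *)
Lemma ge0_integral_normal (f : R -> \bar R) :
  measurable_fun setT f -> (forall x, 0 <= f x)%E ->
  (\int[gauss]_x f x = \int[mu]_x (f x * (phi x)%:E))%E.
Proof.
move=> mf f0; have dom := @normal_prob_dominates R 0 1.
rewrite -(@Radon_Nikodym_SigmaFinite.change_of_variables _ _ R gauss mu dom)//.
have mphi : measurable_fun setT (fun x => (phi x)%:E).
  by apply/measurable_EFinP; exact: measurable_normal_pdf.
have ig := Radon_Nikodym_SigmaFinite.f_integrable dom.
apply: ae_eq_integral => //.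
- by apply: emeasurable_funM => //; exact: measurable_int ig.
- exact: emeasurable_funM.
- apply: ae_eqe_mul2l; apply: integral_ae_eq => //= E _ mE.
  by rewrite -Radon_Nikodym_SigmaFinite.f_integral.
Qed.

Context (h : R -> R).
Hypothesis hlip : forall x y, `|h x - h y| <= `|x - y|.

Lemma lipschitz_normal_integrable : gauss.-integrable setT (EFin \o h).
Proof.
have mh : measurable_fun setT h.
  exact: continuous_measurable_fun (lipschitz_continuous hlip).
apply/integrableP; split; first exact/measurable_EFinP.
rewrite ge0_integral_normal//; last first.
  by apply: measurableT_comp => //; exact/measurable_EFinP.
have /integrableP[_] := integrable_shift_phi hlip 0 (@measurableT _ R).
congr (_ < _)%E; apply: eq_integral => t _ /=.
by rewrite subr0 normrM EFinM (ger0_norm (normal_pdf_ge0 _ _ _)).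
Qed.

(** The change of density is known for nonnegative functions, so it is applied to
    the terms of [h = (h + `|h|) - `|h|]. *)
Lemma lipschitz_normal_mean :
  (\int[gauss]_t (h t)%:E)%E = (gauss_mean h)%:E.
Proof.
have mh : measurable_fun setT h.
  exact: continuous_measurable_fun (lipschitz_continuous hlip).
have ih := lipschitz_normal_integrable.
have iah : gauss.-integrable setT (EFin \o (fun t => `|h t|)).
  exact: integrable_norm ih.
have ihphi := integrable_shift_phi hlip 0 (@measurableT _ R).
have G (k : R -> R) : measurable_fun setT k -> (forall t, 0 <= k t) ->
    \int[gauss]_t k t = \int[mu]_t (k t * phi t).
  move=> mk k0; congr fine; rewrite ge0_integral_normal//.
  exact/measurable_EFinP.
have mah : measurable_fun setT (fun t => `|h t|) by exact: measurableT_comp.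
have iabsphi : mu.-integrable setT (EFin \o (fun t => `|h t| * phi t)).
  have := integrable_norm ihphi.
  apply: eq_integrable => // t _ /=.
  by rewrite subr0 normrM (ger0_norm (normal_pdf_ge0 _ _ _)).
have ihphi0 : mu.-integrable setT (EFin \o (fun t => h t * phi t)).
  by apply: eq_integrable ihphi => // t _ /=; rewrite subr0.
rewrite -[LHS]fineK ?integrable_fin_num//; congr EFin.
have E1 : \int[gauss]_t (h t + `|h t|) = \int[gauss]_t h t + \int[gauss]_t `|h t|.
  exact: RintegralD.
have E2 : \int[mu]_t ((h t + `|h t|) * phi t)
    = gauss_mean h + \int[mu]_t (`|h t| * phi t).
  by rewrite /gauss_mean -RintegralD//; apply: eq_Rintegral => t _; rewrite mulrDl.
move: E1; rewrite (G (fun t => h t + `|h t|)).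
- by rewrite (G (fun t => `|h t|))// E2 => /addIr.
- exact: measurable_funD.
- by move=> t; rewrite -lerBlDl sub0r -normrN ler_norm.
Qed.

Lemma expectation_lipschitz_normal d (T : measurableType d)
    (Q : probability T R) (Z : {RV Q >-> R}) :
  (forall A : set R, measurable A -> distribution Q Z A = gauss A) ->
  ('E_Q[h \o Z] = (gauss_mean h)%:E)%E.
Proof.
move=> QZ.
have mh : measurable_fun setT h.
  exact: continuous_measurable_fun (lipschitz_continuous hlip).
have mZ : measurable_fun setT (Z : T -> measurableTypeR R).
  exact: (@measurable_funPT _ _ _ _ Z).
(* Z is read as taking values in the Borel sigma-algebra generated by the
   half-open intervals, on which the Lebesgue measure is defined. *)
pose Z' : {RV Q >-> measurableTypeR R} :=
  @mfun_Sub _ _ T (measurableTypeR R) Z (mem_set mZ).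
have E f : (\int[distribution Q Z']_t f t = \int[gauss]_t f t)%E.
  by apply: eq_measure_integral => A mA _; exact: QZ.
have mEh : measurable_fun setT (EFin \o h) by exact/measurable_EFinP.
rewrite unlock -lipschitz_normal_mean -E integral_distribution//.
apply/integrableP; split; first exact: measurableT_comp.
have /integrableP[_] := lipschitz_normal_integrable.
by rewrite -E ge0_integral_distribution//; exact: measurableT_comp.
Qed.

End NormalExpectation.

(** * Products of independent random variables *)

Section ProductExpectation.
Context d (T : measurableType d) (R : realType) (P : probability T R).
Variables U V : T -> R.
Hypotheses (mU : measurable_fun setT U) (mV : measurable_fun setT V).
Hypotheses (iU : P.-integrable setT (EFin \o U)).
Hypotheses (iV : P.-integrable setT (EFin \o V)).
Hypothesis indepUV : forall A B : set R, measurable A -> measurable B ->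
  P (U @^-1` A `&` V @^-1` B) = (P (U @^-1` A) * P (V @^-1` B))%E.

Let U' : {RV P >-> R} := mfun_Sub (mem_set mU).
Let V' : {RV P >-> R} := mfun_Sub (mem_set mV).

Let mUV : measurable_fun setT (fun w => (U w, V w)).
Proof. exact: measurable_fun_pair. Qed.

Let UV' : {RV P >-> (R * R)%type} := mfun_Sub (mem_set mUV).

(** Independence says that the law of the pair is the product of the two laws. *)
Let joint f : (\int[distribution P UV']_z f z =
  \int[distribution P U' \x distribution P V']_z f z)%E.
Proof.
apply: eq_measure_integral => A mA _; apply/esym.
have := @product_measure_unique _ _ _ _ R (distribution P U') (distribution P V')
  (distribution P UV').
apply => // B C mB mC; exact: indepUV.
Qed.

Let mmul : measurable_fun setT (fun z : R * R => (z.1 * z.2)%:E).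
Proof. by apply/measurable_EFinP; apply: measurable_funM. Qed.

Let distr_integral (W : {RV P >-> R}) : P.-integrable setT (EFin \o W) ->
  (\int[distribution P W]_y y%:E = \int[P]_w (W w)%:E)%E.
Proof. by move=> iW; rewrite integral_distribution//; exact/measurable_EFinP. Qed.

Let distr_integrable (W : {RV P >-> R}) : P.-integrable setT (EFin \o W) ->
  (distribution P W).-integrable setT EFin.
Proof.
by move=> iW; apply: integrable_pushforward => //; exact/measurable_EFinP.
Qed.

Let imul : (distribution P U' \x distribution P V')%E.-integrable setT
  (fun z : R * R => (z.1 * z.2)%:E).
Proof.
apply/integrable12ltyP => //=.
have /integrableP[_ iU1] := @distr_integrable U' iU.
have /integrableP[_ iV1] := @distr_integrable V' iV.
under eq_integral => x _.
  under eq_integral => y _ do rewrite normrM EFinM.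
  rewrite ge0_integralZl//=; last first.
    by apply/measurable_EFinP; exact: normr_measurable.
  over.
rewrite ge0_integralZr//=.
- by rewrite lte_mul_pinfty// ?integral_ge0// ge0_fin_numE ?integral_ge0.
- by apply/measurable_EFinP; exact: normr_measurable.
- exact: integral_ge0.
Qed.

Lemma integrable_indep_mul : P.-integrable setT (EFin \o (U \* V)).
Proof.
have /integrableP[_] := imul; rewrite -joint => foo.
apply/integrableP; split; first exact/measurable_EFinP/measurable_funM.
apply: le_lt_trans foo; rewrite ge0_integral_distribution//.
by apply: measurableT_comp.
Qed.

Lemma Rintegral_indep_mul :
  \int[P]_w (U w * V w) = (\int[P]_w U w) * (\int[P]_w V w).
Proof.
rewrite -fineM; [|exact: integrable_fin_num|exact: integrable_fin_num].
congr fine; transitivity (\int[distribution P UV']_z (z.1 * z.2)%:E)%E.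
  by rewrite integral_distribution//; exact: integrable_indep_mul.
rewrite joint -integral12_prod_meas1//= /fubini_F/=.
under eq_integral => x _.
  under eq_integral => y _ do rewrite EFinM.
  rewrite integralZl//=; last exact: (@distr_integrable V' iV).
  rewrite (@distr_integral V' iV).
  over.
rewrite -(fineK (integrable_fin_num _ iV))// integralZr//; last exact: (@distr_integrable U' iU).
by rewrite (@distr_integral U' iU).
Qed.

End ProductExpectation.

(** * Independence of generated sigma-algebras *)

Section SigmaIndependence.
Context d (T : measurableType d) (R : realType) (P : probability T R).
Context (I : choiceType) (G : I -> set (set T)).
Hypothesis Gind : mutually_independent P G.
Hypothesis Gmeas : forall i A, G i A -> measurable A.
Hypothesis GT : forall i, G i setT.
Hypothesis GI : forall i A B, G i A -> G i B -> G i (A `&` B).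

(** A pi-system that generates the join of the [G i], [i] in [J]. *)
Definition cylinders (J : {fset I}) : set (set T) :=
  [set B | exists2 A : I -> set T, (forall i, i \in J -> G i (A i)) &
     B = \bigcap_(i in [set` J]) A i].

Lemma cylinder_gen (J : {fset I}) i A : i \in J -> G i A -> cylinders J A.
Proof.
move=> iJ GA; exists (fun k => if k == i then A else setT).
  by move=> k kJ; case: eqP => [->//|_]; exact: GT.
apply/seteqP; split => [x Ax k _|x /(_ i iJ)].
  by case: eqP.
by rewrite eqxx.
Qed.

Lemma cylindersI J : setI_closed (cylinders J).
Proof.
move=> _ _ [A GA ->] [B GB ->]; exists (fun i => A i `&` B i).
  by move=> i iJ; apply: GI; [exact: GA|exact: GB].
by rewrite bigcapI.
Qed.

Lemma cylinders_measurable J : cylinders J `<=` measurable.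
Proof.
move=> _ [A GA ->]; apply: fin_bigcap_measurable; first exact: finite_fset.
by move=> i iJ; exact: Gmeas (GA _ iJ).
Qed.

(** Mutual independence gives the product rule on the pi-system [cylinders J].
    For fixed [A], the two sides are finite measures in [B], so they agree on
    the generated sigma-algebra. *)
Lemma indep_sigma_cylinders J j A B : j \notin J -> G j A ->
  <<s cylinders J >> B -> P (A `&` B) = (P A * P B)%E.
Proof.
move=> jJ GA sB.
have mA := Gmeas GA.
pose c : {nonneg R} := NngNum (fine_ge0 (measure_ge0 P A)).
pose m1 : {measure set T -> \bar R} := mrestr P mA.
pose m2 : {measure set T -> \bar R} := mscale c P.
have m1E X : m1 X = P (A `&` X) by rewrite setIC.
have m2E X : m2 X = (P A * P X)%E.
  by rewrite /m2 /= /mscale /= fineK// fin_num_measure.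
rewrite -m1E -m2E.
apply: (g_sigma_algebra_measure_unique (cylinders J)
  (@cylinders_measurable J) (fun=> setT)) => //.
- move=> _; exists (fun=> setT); first by move=> i _; exact: GT.
  by apply/seteqP; split.
- by apply/seteqP; split => // x _; exists 0%N.
- exact: cylindersI.
- move=> _ [C GC ->]; rewrite m1E m2E.
  pose D i := if i == j then A else C i.
  have CD : \bigcap_(i in [set` J]) C i = \bigcap_(i in [set` J]) D i.
    apply: eq_bigcapr => i /= iJ; rewrite /D; case: eqP => // ij.
    by move: jJ; rewrite -ij iJ.
  have GD i : i \in J -> G i (D i).
    by rewrite /D; case: eqP => [-> _//|_]; exact: GC.
  rewrite CD (Gind GD).
  have Dj : D j = A by rewrite /D eqxx.
  have GDj i : i \in (j |` J)%fset -> G i (D i).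
    by rewrite !inE => /orP[/eqP->|]; [rewrite Dj|exact: GD].
  have := Gind GDj; rewrite big_fsetU1//= Dj => <-.
  by congr (P _); rewrite set_fsetU set_fset1 bigcap_setU bigcap_set1 Dj.
- by move=> _; rewrite m1E setIT ltey_eq fin_num_measure.
Qed.

End SigmaIndependence.

(** * Real-valued expectations *)

Section Expectation.
Context d (T : measurableType d) (R : realType) (P : probability T R).
Implicit Types f g : T -> R.

Definition Rintegrable f := P.-integrable setT (EFin \o f).

Lemma Rintegrable_measurable f : Rintegrable f -> measurable_fun setT f.
Proof. by case/integrableP => /measurable_EFinP. Qed.

Lemma RintegrableD f g :
  Rintegrable f -> Rintegrable g -> Rintegrable (fun w => f w + g w).
Proof. exact: integrableD. Qed.

Lemma RintegrableZ c f : Rintegrable f -> Rintegrable (fun w => c * f w).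
Proof. exact: integrableZl. Qed.

Lemma RintegrableB f g :
  Rintegrable f -> Rintegrable g -> Rintegrable (fun w => f w - g w).
Proof. exact: integrableB. Qed.

Lemma Rintegrable_norm f : Rintegrable f -> Rintegrable (fun w => `|f w|).
Proof. exact: integrable_norm. Qed.

Lemma Rintegrable_le f g : measurable_fun setT f ->
  (forall w, `|f w| <= g w) -> Rintegrable g -> Rintegrable f.
Proof.
move=> mf fg ig; apply: le_integrable ig => //; first exact/measurable_EFinP.
by move=> w _ /=; rewrite lee_fin (le_trans (fg w))// ler_norm.
Qed.

Lemma Rintegrable_cst c : Rintegrable (fun=> c).
Proof. exact: finite_measure_integrable_cst. Qed.

Lemma Rintegrable_bounded f c :
  measurable_fun setT f -> (forall w, `|f w| <= c) -> Rintegrable f.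
Proof. by move=> mf fc; apply: (Rintegrable_le mf fc); exact: Rintegrable_cst. Qed.

Lemma Rintegrable_sum n (f : nat -> T -> R) :
  (forall j, (j < n)%N -> Rintegrable (f j)) ->
  Rintegrable (fun w => \sum_(j < n) f j w).
Proof.
elim: n => [|n IH] fi.
  by under [X in Rintegrable X]eq_fun do rewrite big_ord0; exact: Rintegrable_cst.
under [X in Rintegrable X]eq_fun do rewrite big_ord_recr/=.
by apply: RintegrableD; [apply: IH => j jn; apply: fi; rewrite ltnW|exact: fi].
Qed.

Lemma Rintegral_sum n (f : nat -> T -> R) :
  (forall j, (j < n)%N -> Rintegrable (f j)) ->
  \int[P]_w (\sum_(j < n) f j w) = \sum_(j < n) \int[P]_w f j w.
Proof.
elim: n => [|n IH] fi.
  under eq_Rintegral do rewrite big_ord0.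
  by rewrite big_ord0 Rintegral_cst// mul0r.
under eq_Rintegral do rewrite big_ord_recr/=.
rewrite big_ord_recr/= RintegralD//.
- by rewrite IH// => j jn; apply: fi; rewrite ltnW.
- by apply: Rintegrable_sum => j jn; apply: fi; rewrite ltnW.
- exact: fi.
Qed.

Lemma Rintegral_prob_cst c : \int[P]_w c = c.
Proof. by rewrite Rintegral_cst//= probability_setT mulr1. Qed.

Lemma Rintegral_norm_le f : Rintegrable f -> `|\int[P]_w f w| <= \int[P]_w `|f w|.
Proof. exact: le_normr_Rintegral. Qed.

Lemma Rintegral_le f g : Rintegrable f -> Rintegrable g ->
  (forall w, f w <= g w) -> \int[P]_w f w <= \int[P]_w g w.
Proof. by move=> fi gi fg; apply: le_Rintegral. Qed.

(** Expand [0 <= E (`|f| - E `|f|) ^+ 2]. *)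
Lemma Rintegral_norm_le_sqrt f : Rintegrable (fun w => f w ^+ 2) ->
  Rintegrable f -> \int[P]_w `|f w| <= Num.sqrt (\int[P]_w f w ^+ 2).
Proof.
move=> f2 fi; set a := \int[P]_w `|f w|.
have a0 : 0 <= a by apply: Rintegral_ge0.
have fa := Rintegrable_norm fi.
rewrite -[a]ger0_norm// -sqrtr_sqr ler_sqrt; last by apply: Rintegral_ge0 => w _; exact: sqr_ge0.
rewrite -subr_ge0.
have -> : \int[P]_w f w ^+ 2 - a ^+ 2 =
    \int[P]_w ((f w ^+ 2 - 2 * a * `|f w|) + a ^+ 2).
  rewrite RintegralD//; [|by apply: RintegrableB => //; exact: RintegrableZ|exact: Rintegrable_cst].
  rewrite RintegralB//; last exact: RintegrableZ.
  by rewrite RintegralZl// Rintegral_prob_cst -/a; ring.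
apply: Rintegral_ge0 => w _; rewrite -(real_normK (num_real (f w))).
by have := sqr_ge0 (`|f w| - a); rewrite sqrrB; lra.
Qed.

End Expectation.

(** * Decomposition along the values of the number of summands *)

Section CountableDecomposition.
Context d (T : measurableType d) (R : realType) (P : probability T R).
Context (N : {RV P >-> nat}).

Definition level n w : R := (N w == n)%:R.

Lemma level_set n : measurable (N @^-1` [set n]).
Proof. by rewrite -[X in measurable X]setTI; exact: measurable_funPT. Qed.

Lemma levelE n : level n = \1_(N @^-1` [set n]).
Proof.
apply/funext => w; rewrite indicE /level; congr (nat_of_bool _)%:R.
by apply/eqP/idP => [E|/set_mem]; [apply/mem_set|].
Qed.

Lemma measurable_level n : measurable_fun setT (level n).
Proof. by rewrite levelE; apply: measurable_indic; exact: level_set. Qed.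

Lemma level_norm_le1 n w : `|level n w| <= 1.
Proof. by rewrite /level; case: (_ == _); rewrite ?normr1 ?normr0. Qed.

Lemma level_ge0 n w : 0 <= level n w. Proof. by rewrite /level. Qed.

Lemma Rintegrable_level n : Rintegrable P (level n).
Proof.
apply: Rintegrable_bounded; [exact: measurable_level|exact: level_norm_le1].
Qed.

Lemma level_congr n (f : nat -> T -> R) w :
  level n w * f (N w) w = level n w * f n w.
Proof. by rewrite /level; case: eqP => [->//|_]; rewrite !mul0r. Qed.

Lemma sum_level m w : \sum_(n < m) level n w = (N w < m)%N%:R.
Proof.
rewrite /level; have [Nm|mN] := ltnP (N w) m.
  rewrite (bigD1 (Ordinal Nm))//= eqxx big1 ?addr0// => i iN.
  by case: eqP => // E; rewrite -val_eqE/= E eqxx in iN.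
by rewrite big1// => i _; case: eqP => // E; have := ltn_ord i; rewrite -E ltnNge mN.
Qed.

Lemma measurable_levelwise (G : T -> R) :
  (forall n, measurable_fun setT (fun w => level n w * G w)) ->
  measurable_fun setT G.
Proof.
move=> mG _ B mB; rewrite setTI.
have -> : G @^-1` B = \bigcup_n (N @^-1` [set n] `&`
    (setT `&` (fun w => level n w * G w) @^-1` B)).
  apply/seteqP; split => [w Bw|w [n _ [/= Nn [_]]]].
    by exists (N w) => //; split => //; split => //=; rewrite /level eqxx mul1r.
  by rewrite /level Nn eqxx mul1r.
apply: bigcupT_measurable => n; apply: measurableI; first exact: level_set.
exact: mG.
Qed.

Let pN n := \int[P]_w level n w.

Hypothesis iN : Rintegrable P (fun w => (N w)%:R).

Let EN := \int[P]_w (N w)%:R.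

Lemma sum_level_mean m : \sum_(n < m) n%:R * pN n <= EN.
Proof.
have -> : \sum_(n < m) n%:R * pN n =
    \int[P]_w (\sum_(n < m) n%:R * level n w).
  rewrite (@Rintegral_sum _ _ _ P m (fun n w => n%:R * level n w)).
    by apply: eq_bigr => n _; rewrite RintegralZl//; exact: Rintegrable_level.
  by move=> n _; apply: RintegrableZ; exact: Rintegrable_level.
apply: Rintegral_le => //.
  apply: (@Rintegrable_sum _ _ _ P m (fun n w => n%:R * level n w)).
  by move=> n _; apply: RintegrableZ; exact: Rintegrable_level.
move=> w; have -> : \sum_(n < m) n%:R * level n w = \sum_(n < m) level n w * (N w)%:R.
  apply: eq_bigr => n _.
  by rewrite (level_congr n (fun k _ => k%:R)) mulrC.
by rewrite -mulr_suml sum_level; case: (_ < _)%N; rewrite ?mul1r ?mul0r.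
Qed.

(** [G] restricted to the event that [N < m]. *)
Let trunc m (G : T -> R) w := \sum_(n < m) level n w * G w.

Let trunc_cvg G w : (trunc m G w)%:E @[m --> \oo] --> (G w)%:E.
Proof.
apply: cvg_EFin; first by apply: nearW.
apply: cvg_near_cst; near=> m; rewrite /trunc/= -mulr_suml sum_level.
have -> : (N w < m)%N by near: m; exact: nbhs_infty_gt.
by rewrite mul1r.
Unshelve. all: by end_near. Qed.

Let trunc_norm m G w : `|trunc m G w| <= `|G w|.
Proof.
rewrite /trunc -mulr_suml sum_level.
by case: (_ < _)%N; rewrite ?mul1r// mul0r normr0.
Qed.

Let trunc_integrable m G : (forall n, Rintegrable P (fun w => level n w * G w)) ->
  Rintegrable P (trunc m G).
Proof.
by move=> iG; apply: (@Rintegrable_sum _ _ _ P m (fun n w => level n w * G w)).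
Qed.

Let trunc_integral m G : (forall n, Rintegrable P (fun w => level n w * G w)) ->
  \int[P]_w trunc m G w = \sum_(n < m) \int[P]_w (level n w * G w).
Proof.
by move=> iG; rewrite (@Rintegral_sum _ _ _ P m (fun n w => level n w * G w)).
Qed.

(** Monotone convergence over the events [N < m], together with
    [E N = \sum_n n * P (N = n)]. *)
Lemma integrable_levelwise (G : T -> R) (c : R) : (forall w, 0 <= G w) ->
  0 <= c ->
  (forall n, Rintegrable P (fun w => level n w * G w)) ->
  (forall n, \int[P]_w (level n w * G w) <= c * (n%:R * pN n)) ->
  Rintegrable P G.
Proof.
move=> G0 c0 iG Gle.
have mG : measurable_fun setT G.
  by apply: measurable_levelwise => n; exact: Rintegrable_measurable (iG n).
apply/integrableP; split; first exact/measurable_EFinP.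
apply: (@le_lt_trans _ _ (c * EN)%:E); last exact: ltry.
have -> : (\int[P]_w `|(EFin \o G) w| =
    \int[P]_w limn (fun m => (trunc m G w)%:E))%E.
  apply: eq_integral => w _; rewrite /= ger0_norm//.
  by apply/esym/cvg_lim => //; exact: trunc_cvg.
have cvgI := @cvg_monotone_convergence _ _ _ P setT measurableT
  (fun m w => (trunc m G w)%:E).
rewrite -(cvg_lim _ (cvgI _ _ _))//; last 3 first.
- by move=> m; apply/measurable_EFinP; exact: Rintegrable_measurable (trunc_integrable m iG).
- by move=> m w _; rewrite lee_fin sumr_ge0// => n _; rewrite mulr_ge0.
- move=> w _ m k mk; rewrite lee_fin /trunc -!mulr_suml !sum_level.
  rewrite ler_wpM2r// ler_nat; case: ltnP => // Nm.
  by rewrite (leq_trans Nm mk).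
apply: lime_le.
  apply: ereal_nondecreasing_is_cvgn => m k mk.
  apply: ge0_le_integral => //.
  - by move=> w _; rewrite lee_fin sumr_ge0// => n _; rewrite mulr_ge0.
  - by apply/measurable_EFinP; exact: Rintegrable_measurable (trunc_integrable m iG).
  - by apply/measurable_EFinP; exact: Rintegrable_measurable (trunc_integrable k iG).
  - move=> w _; rewrite lee_fin /trunc -!mulr_suml !sum_level.
    rewrite ler_wpM2r// ler_nat; case: ltnP => // Nm.
    by rewrite (leq_trans Nm mk).
near=> m.
rewrite -[leLHS]fineK; last exact: integrable_fin_num (trunc_integrable m iG).
rewrite lee_fin -/(\int[P]_w trunc m G w) trunc_integral//.
apply: (@le_trans _ _ (c * \sum_(n < m) n%:R * pN n)).
  by rewrite mulr_sumr; apply: ler_sum => n _.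
by rewrite ler_wpM2l// sum_level_mean.
Unshelve. all: by end_near. Qed.

(** An estimate that is linear in [n] on every event [N = n] sums up to [E N].
    Dominated convergence over the events [N < m] allows [G] to change sign. *)
Lemma integral_levelwise_le (G : T -> R) (c : R) : 0 <= c -> Rintegrable P G ->
  (forall n, `|\int[P]_w (level n w * G w)| <= c * (n%:R * pN n)) ->
  `|\int[P]_w G w| <= c * EN.
Proof.
move=> c0 iG Gle.
have iGn n : Rintegrable P (fun w => level n w * G w).
  apply: (@Rintegrable_le _ _ _ _ _ (fun w => `|G w|)).
  - by apply: measurable_funM; [exact: measurable_level|exact: Rintegrable_measurable iG].
  - by move=> w; rewrite normrM ler_piMl// level_norm_le1.
  - exact: (Rintegrable_norm iG).
have cvgG : \int[P]_w trunc m G w @[m --> \oo] --> \int[P]_w G w.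
  apply: fine_cvg; rewrite fineK; last exact: integrable_fin_num.
  apply: (@dominated_cvg _ _ _ P setT _ _ _ (fun w => (`|G w|)%:E)) => //.
  - by move=> m; apply/measurable_EFinP; exact: Rintegrable_measurable (trunc_integrable m iGn).
  - exact: (Rintegrable_norm iG).
  - by move=> m w _ /=; rewrite lee_fin trunc_norm.
have cvgN : `|\int[P]_w trunc m G w| @[m --> \oo] --> `|\int[P]_w G w|.
  exact: cvg_norm cvgG.
rewrite -(cvg_lim (@Rhausdorff R) cvgN).
apply: limr_le; first by apply/cvg_ex; eexists; exact: cvgN.
near=> m; rewrite trunc_integral//.
apply: (le_trans (ler_norm_sum _ _ _)).
apply: (@le_trans _ _ (c * \sum_(n < m) n%:R * pN n)).
  by rewrite mulr_sumr; apply: ler_sum => n _.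
by rewrite ler_wpM2l// sum_level_mean.
Unshelve. all: by end_near. Qed.

Lemma integral_levelwise_eq (G : T -> R) (c : R) : Rintegrable P G ->
  (forall n, \int[P]_w (level n w * G w) = c * (n%:R * pN n)) ->
  \int[P]_w G w = c * EN.
Proof.
move=> iG Gle; apply/eqP; rewrite -subr_eq0 -normr_le0.
rewrite -RintegralZl// -RintegralB//; last exact: RintegrableZ.
rewrite -(mul0r EN); apply: integral_levelwise_le => //.
  by apply: RintegrableB => //; exact: RintegrableZ.
move=> n; rewrite mul0r normr_le0.
have -> : (fun w => level n w * (G w - c * (N w)%:R)) =
    (fun w => level n w * G w - c * n%:R * level n w).
  apply/funext => w; rewrite mulrBr; congr (_ - _).
  by rewrite mulrCA (level_congr n (fun k _ => k%:R)); ring.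
have iGn : Rintegrable P (fun w => level n w * G w).
  apply: (@Rintegrable_le _ _ _ _ _ (fun w => `|G w|)).
  - by apply: measurable_funM; [exact: measurable_level|exact: Rintegrable_measurable iG].
  - by move=> w; rewrite normrM ler_piMl// level_norm_le1.
  - exact: (Rintegrable_norm iG).
rewrite RintegralB//; last by apply: RintegrableZ; exact: Rintegrable_level.
rewrite RintegralZl//; last exact: Rintegrable_level.
by rewrite Gle subr_eq0 mulrA.
Qed.

End CountableDecomposition.

(** * Moments of random sums *)

Section RandomSum.
Context d (T : measurableType d) (R : realType) (P : probability T R).
Context (N : {RV P >-> nat}) (X : nat -> {RV P >-> R}).
Hypothesis indNX : mutually_independent P (sigma_N_X N X).
Hypothesis idX : forall (j : nat) (A : set R), measurable A ->
  distribution P (X j) A = distribution P (X 0%N) A.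

Let G := sigma_N_X N X.

Let G_measurable i A : G i A -> measurable A.
Proof. by case: i => [j|] [B mB <-]; exact: measurable_funPT. Qed.

Let G_setT i : G i setT.
Proof. by case: i => [j|]; exists setT => //; rewrite preimage_setT setIT. Qed.

Let G_setI i A B : G i A -> G i B -> G i (A `&` B).
Proof.
by case: i => [j|] [C mC <-] [D mD <-]; exists (C `&` D);
  rewrite ?preimage_setI ?setTI//; exact: measurableI.
Qed.

(** [None] is the index of [N]: on the event [N = n], a random sum deprived of
    its [j]-th term depends only on the variables with these indices. *)
Definition other_indices (n j : nat) : {fset option nat} :=
  [fset i in None :: [seq Some i | i <- iota 0 n & i != j]]%fset.

Let cyl n j := cylinders G (other_indices n j).

Definition leave_one_out_measurable n j (V : T -> R) :=
  measurable_fun (setT : set (g_sigma_algebraType (cyl n j))) V.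

Lemma leave_one_out_measurable_fun n j V :
  leave_one_out_measurable n j V -> measurable_fun setT V.
Proof.
move=> mV _ B mB; have := mV measurableT B mB.
apply: smallest_sub; first exact: sigma_algebra_measurable.
exact: cylinders_measurable.
Qed.

Lemma leave_one_out_level n j : leave_one_out_measurable n j (level N n).
Proof.
rewrite levelE; apply: measurable_indic; apply: sub_sigma_algebra.
apply: (cylinder_gen G_setT (i := None)); first by rewrite !inE.
by exists [set n] => //; rewrite setTI.
Qed.

Lemma leave_one_out_X n j i : (i < n)%N -> i != j ->
  leave_one_out_measurable n j (X i).
Proof.
move=> lt_in ij _ B mB; apply: sub_sigma_algebra.
apply: (cylinder_gen G_setT (i := Some i)).
  rewrite !inE/=; apply/mapP; exists i => //.
  by rewrite mem_filter ij mem_iota add0n.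
by exists B.
Qed.

(** [X j] is independent of everything built from [N] and the [X i] with
    [i < n], [i != j]. *)
Lemma leave_one_out_indep n j (u : R -> R) V :
  measurable_fun setT u -> Rintegrable P (u \o X j) ->
  leave_one_out_measurable n j V -> Rintegrable P V ->
  Rintegrable P (fun w => u (X j w) * V w) /\
  \int[P]_w (u (X j w) * V w) = (\int[P]_w u (X j w)) * (\int[P]_w V w).
Proof.
move=> mu iu mV iV.
have ind A B : measurable A -> measurable B ->
    P ((u \o X j) @^-1` A `&` V @^-1` B) = (P ((u \o X j) @^-1` A) * P (V @^-1` B))%E.
  move=> mA mB.
  apply: (@indep_sigma_cylinders _ _ _ P _ G indNX G_measurable G_setT G_setI
    (other_indices n j) (Some j)).
  - by rewrite !inE/=; apply/mapP => -[i]; rewrite mem_filter => /andP[/eqP ij _] [] /esym /ij.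
  - exists (u @^-1` A); last by rewrite setTI.
    by rewrite -[X in measurable X]setTI; exact: mu.
  - by have := mV measurableT B mB; rewrite setTI.
have mUX : measurable_fun setT (u \o X j) by exact: measurableT_comp.
have mV' := leave_one_out_measurable_fun mV.
split; first exact: (integrable_indep_mul mUX mV' iu iV ind).
exact: (Rintegral_indep_mul mUX mV' iu iV ind).
Qed.

Lemma identically_distributed (u : R -> R) j : measurable_fun setT u ->
  Rintegrable P (u \o X 0%N) ->
  Rintegrable P (u \o X j) /\ \int[P]_w u (X j w) = \int[P]_w u (X 0%N w).
Proof.
move=> mu iu.
have E f : (\int[distribution P (X j)]_x f x = \int[distribution P (X 0%N)]_x f x)%E.
  by apply: eq_measure_integral => A mA _; exact: idX.
have mEu : measurable_fun setT (EFin \o u) by exact/measurable_EFinP.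
have iuj : Rintegrable P (u \o X j).
  apply/integrableP; split; first exact/measurable_EFinP/measurableT_comp.
  have /integrableP[_] := iu.
  have mau : measurable_fun setT (fun x => `|(EFin \o u) x|)%E.
    exact: measurableT_comp.
  have := @ge0_integral_distribution _ _ _ _ _ P (X j) _ mau (fun=> abse_ge0 _).
  have := @ge0_integral_distribution _ _ _ _ _ P (X 0%N) _ mau (fun=> abse_ge0 _).
  by rewrite E => -> ->.
split=> //; congr fine.
have := integral_distribution mEu iu; have := integral_distribution mEu iuj.
by rewrite E => -> ->.
Qed.

Hypothesis iN : Rintegrable P (fun w => (N w)%:R).
Let EN := \int[P]_w (N w)%:R.
Let pN n := \int[P]_w level N n w.

Let level_random_sum n (v : R -> R) w :
  level N n w * random_sum N (fun j w => v (X j w)) w =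
  \sum_(j < n) v (X j w) * level N n w.
Proof.
rewrite (level_congr N n (fun n w => \sum_(j < n) v (X j w))) mulr_sumr.
by apply: eq_bigr => j _; rewrite mulrC.
Qed.

Lemma level_moment (v : R -> R) n j : measurable_fun setT v -> Rintegrable P (v \o X 0%N) ->
  Rintegrable P (fun w => v (X j w) * level N n w) /\
  \int[P]_w (v (X j w) * level N n w) = (\int[P]_w v (X 0%N w)) * \int[P]_w level N n w.
Proof.
move=> mv iv; have [ivj <-] := identically_distributed j mv iv.
have := @leave_one_out_indep n j v (level N n) mv ivj (@leave_one_out_level n j).
by apply; exact: Rintegrable_level.
Qed.

Lemma measurable_random_sum (v : R -> R) : measurable_fun setT v ->
  measurable_fun setT (random_sum N (fun j w => v (X j w))).
Proof.
move=> mv; apply: (@measurable_levelwise _ _ _ P N) => n.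
rewrite (funext (level_random_sum n v)).
apply: measurable_sum => j; apply: measurable_funM; last exact: measurable_level.
exact: measurableT_comp.
Qed.

(** Wald's identity: on [N = n] the sum has [n] terms, and each of them is
    independent of this event. *)
Lemma wald1 (v : R -> R) : measurable_fun setT v -> Rintegrable P (v \o X 0%N) ->
  Rintegrable P (random_sum N (fun j w => v (X j w))) /\
  \int[P]_w random_sum N (fun j w => v (X j w)) w = (\int[P]_w v (X 0%N w)) * EN.
Proof.
move=> mv iv.
have lvl u n : measurable_fun setT u -> Rintegrable P (u \o X 0%N) ->
    Rintegrable P (fun w => level N n w * random_sum N (fun j w => u (X j w)) w) /\
    \int[P]_w (level N n w * random_sum N (fun j w => u (X j w)) w) =
    (\int[P]_w u (X 0%N w)) * (n%:R * pN n).
  move=> mu iu.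
  have lm j := level_moment n j mu iu.
  split.
    under [X in Rintegrable _ X]eq_fun do rewrite level_random_sum.
    by apply: (@Rintegrable_sum _ _ _ P n (fun j w => u (X j w) * level N n w)) => j _; case: (lm j).
  under eq_Rintegral do rewrite level_random_sum.
  rewrite (@Rintegral_sum _ _ _ P n (fun j w => u (X j w) * level N n w)); last first.
    by move=> j _; case: (lm j).
  rewrite (eq_bigr (fun=> (\int[P]_w u (X 0%N w)) * pN n)); last first.
    by move=> j _; case: (lm j).
  by rewrite sumr_const card_ord -mulr_natl; ring.
have mav : measurable_fun setT (fun x => `|v x|) by exact: measurableT_comp.
have iav : Rintegrable P ((fun x => `|v x|) \o X 0%N) by exact: Rintegrable_norm iv.
have iS : Rintegrable P (random_sum N (fun j w => v (X j w))).
  apply: (@Rintegrable_le _ _ _ _ _ (random_sum N (fun j w => `|v (X j w)|))).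
  - exact: measurable_random_sum.
  - by move=> w; exact: ler_norm_sum.
  - apply: (integrable_levelwise iN (c := \int[P]_w `|v (X 0%N w)|)).
    + by move=> w; rewrite sumr_ge0.
    + exact: Rintegral_ge0.
    + by move=> n; have [] := lvl _ n mav iav.
    + by move=> n; have [_ ->] := lvl _ n mav iav.
split=> //; apply: integral_levelwise_eq => // n.
by have [_ ->] := lvl _ n mv iv.
Qed.

(** Wald's second identity: on [N = n] the cross terms of the square have mean
    zero by independence, and only the [n] squares remain. *)
Lemma wald2 (v : R -> R) : measurable_fun setT v -> Rintegrable P (v \o X 0%N) ->
  Rintegrable P (fun w => v (X 0%N w) ^+ 2) -> \int[P]_w v (X 0%N w) = 0 ->
  Rintegrable P (fun w => random_sum N (fun j w => v (X j w)) w ^+ 2) /\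
  \int[P]_w random_sum N (fun j w => v (X j w)) w ^+ 2 =
    (\int[P]_w v (X 0%N w) ^+ 2) * EN.
Proof.
move=> mv iv iv2 v0; set S := random_sum _ _; set m2 := \int[P]_w v (X 0%N w) ^+ 2.
have mv2 : measurable_fun setT (fun x => v x ^+ 2) by exact: measurable_funX.
have sqE n w : level N n w * S w ^+ 2 =
    \sum_(i < n) \sum_(j < n) v (X i w) * (level N n w * v (X j w)).
  rewrite (level_congr N n (fun n w => (\sum_(j < n) v (X j w)) ^+ 2)).
  rewrite expr2 mulr_suml mulr_sumr; apply: eq_bigr => i _.
  by rewrite !mulr_sumr; apply: eq_bigr => j _; ring.
have diag n i : Rintegrable P (fun w => v (X i w) * (level N n w * v (X i w))) /\
    \int[P]_w (v (X i w) * (level N n w * v (X i w))) = m2 * pN n.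
  have [] := level_moment n i mv2 iv2.
  have E : (fun w => v (X i w) * (level N n w * v (X i w))) =
           (fun w => v (X i w) ^+ 2 * level N n w).
    by apply/funext => w; ring.
  by rewrite E.
have offdiag n i j : (i < n)%N -> (j < n)%N -> i != j ->
    Rintegrable P (fun w => v (X i w) * (level N n w * v (X j w))) /\
    \int[P]_w (v (X i w) * (level N n w * v (X j w))) = 0.
  move=> ltin ltjn ij.
  have [ivi vi] := identically_distributed i mv iv.
  have := @leave_one_out_indep n i v (fun w => level N n w * v (X j w)) mv ivi.
  rewrite vi v0 mul0r; apply.
    apply: measurable_funM; first exact: leave_one_out_level.
    by apply: measurableT_comp => //; apply: leave_one_out_X => //; rewrite eq_sym.
  have [+ _] := level_moment n j mv iv.
  by under eq_fun do rewrite mulrC.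
have inner n i j : (i < n)%N -> (j < n)%N ->
    Rintegrable P (fun w => v (X i w) * (level N n w * v (X j w))) /\
    \int[P]_w (v (X i w) * (level N n w * v (X j w))) = (i == j)%:R * (m2 * pN n).
  move=> ltin ltjn; have [<-|ij] := eqVneq i j.
    by rewrite mul1r; exact: diag.
  by rewrite mul0r; exact: offdiag.
have lvl n : Rintegrable P (fun w => level N n w * S w ^+ 2) /\
    \int[P]_w (level N n w * S w ^+ 2) = m2 * (n%:R * pN n).
  have irow i : (i < n)%N -> Rintegrable P
      (fun w => \sum_(j < n) v (X i w) * (level N n w * v (X j w))).
    move=> ltin.
    apply: (@Rintegrable_sum _ _ _ P n (fun j w => v (X i w) * (level N n w * v (X j w)))) => j ltjn.
    by have [] := inner n i j ltin ltjn.
  split.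
    under [X in Rintegrable _ X]eq_fun do rewrite sqE.
    exact: (@Rintegrable_sum _ _ _ P n (fun i w =>
      \sum_(j < n) v (X i w) * (level N n w * v (X j w)))).
  under eq_Rintegral do rewrite sqE.
  rewrite (@Rintegral_sum _ _ _ P n (fun i w =>
      \sum_(j < n) v (X i w) * (level N n w * v (X j w))))//.
  rewrite (eq_bigr (fun=> m2 * pN n)).
    by rewrite sumr_const card_ord -mulr_natl; ring.
  move=> i _.
  rewrite (@Rintegral_sum _ _ _ P n (fun j w => v (X i w) * (level N n w * v (X j w)))); last first.
    by move=> j ltjn; have [] := inner n i j (ltn_ord i) ltjn.
  rewrite (bigD1 i)//= big1 ?addr0.
    by have [_ ->] := inner n i i (ltn_ord i) (ltn_ord i); rewrite eqxx mul1r.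
  move=> j ji; have [_ ->] := inner n i j (ltn_ord i) (ltn_ord j).
  by rewrite val_eqE eq_sym (negbTE ji) mul0r.
have iS2 : Rintegrable P (fun w => S w ^+ 2).
  apply: (integrable_levelwise iN (c := m2)).
  - by move=> w; exact: sqr_ge0.
  - by apply: Rintegral_ge0 => w _; exact: sqr_ge0.
  - by move=> n; have [] := lvl n.
  - by move=> n; have [_ ->] := lvl n.
by split=> //; apply: integral_levelwise_eq => // n; have [_ ->] := lvl n.
Qed.

End RandomSum.

(** * The Stein functional of a random sum *)

Section SteinRandomSum.
Context d (T : measurableType d) (R : realType) (P : probability T R).
Context (N : {RV P >-> nat}) (X : nat -> {RV P >-> R}).
Hypothesis indNX : mutually_independent P (sigma_N_X N X).
Hypothesis idX : forall (j : nat) (A : set R), measurable A ->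
  distribution P (X j) A = distribution P (X 0%N) A.
Hypothesis iN : Rintegrable P (fun w => (N w)%:R).
Let EN := \int[P]_w (N w)%:R.
Hypothesis iX : Rintegrable P (X 0%N).
Hypothesis iX2 : Rintegrable P (fun w => X 0%N w ^+ 2).
Hypothesis iX3 : Rintegrable P (fun w => `|X 0%N w| ^+ 3).
Hypothesis X_centered : \int[P]_w X 0%N w = 0.
Let m3 := \int[P]_w `|X 0%N w| ^+ 3.

Let S := random_sum N X.
Let S2 := random_sum N (fun j w => X j w ^+ 2).

Context (f f' : R -> R) (K s : R).
Hypothesis s0 : 0 < s.
Hypothesis mf : measurable_fun setT f.
Hypothesis mf' : measurable_fun setT f'.
Hypothesis f1 : forall x, `|f x| <= 1.
Hypothesis f'K : forall x, `|f' x| <= K.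
Hypothesis f_taylor : forall x y, `|f y - f x - (y - x) * f' x| <= (y - x) ^+ 2.

Let mid : measurable_fun setT (@id R). Proof. exact: measurable_id. Qed.
Let msqr : measurable_fun setT (fun x : R => x ^+ 2).
Proof. exact: measurable_funX. Qed.
Let mcube : measurable_fun setT (fun x : R => `|x| ^+ 3).
Proof. by apply: measurable_funX; exact: normr_measurable. Qed.

Let mS : measurable_fun setT (fun w => S w / s).
Proof.
apply: measurable_funM => //.
exact: (measurable_random_sum N X mid).
Qed.

Let iS : Rintegrable P S.
Proof. by have [] := wald1 indNX idX iN mid iX. Qed.

Let iS2 : Rintegrable P S2.
Proof. by have [] := wald1 indNX idX iN msqr iX2. Qed.

Lemma Rintegrable_stein_main : Rintegrable P (fun w => f' (S w / s) * (S2 w / s ^+ 2)).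
Proof.
apply: (@Rintegrable_le _ _ _ _ _ (fun w => K / s ^+ 2 * S2 w)).
- apply: measurable_funM; first exact: measurableT_comp.
  by apply: measurable_funM => //; exact: Rintegrable_measurable iS2.
- move=> w; rewrite normrM [K / _ * _]mulrAC -mulrA ler_pM//.
  rewrite ger0_norm// divr_ge0 ?sqr_ge0// sumr_ge0// => j _; exact: sqr_ge0.
- exact: RintegrableZ.
Qed.

Lemma Rintegrable_stein_prod : Rintegrable P (fun w => S w / s * f (S w / s)).
Proof.
apply: (@Rintegrable_le _ _ _ _ _ (fun w => s^-1 * `|S w|)).
- by apply: measurable_funM => //; exact: measurableT_comp.
- move=> w; rewrite !normrM (@ger0_norm _ s^-1) ?invr_ge0 ?(ltW s0)// [s^-1 * _]mulrC.
  by rewrite ler_piMr// mulr_ge0// invr_ge0 (ltW s0).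
- exact: RintegrableZ (Rintegrable_norm iS).
Qed.

(** The leave-one-out argument. On [N = n], write [F] for the normalised sum and
    [F_j] for the same sum without its [j]-th term. Then [X j] is centred and
    independent of [f (F_j)] on this event, so [f (F)] may be replaced by
    [f (F) - f (F_j)] in the [j]-th term of [F * f (F)]. By the Taylor bound this
    difference is [X j / s * f' (F)] up to an error [(X j / s) ^+ 2], and the
    [j]-th term is [(X j / s) ^+ 2 * f' (F)] up to [(`|X j| / s) ^+ 3]. *)
Lemma stein_random_sum :
  `|\int[P]_w (f' (S w / s) * (S2 w / s ^+ 2) - S w / s * f (S w / s))|
    <= m3 / s ^+ 3 * EN.
Proof.
have m30 : 0 <= m3 by apply: Rintegral_ge0 => w _; rewrite exprn_ge0.
apply: (integral_levelwise_le iN).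
- by rewrite divr_ge0// exprn_ge0// ltW.
- by apply: RintegrableB; [exact: Rintegrable_stein_main|exact: Rintegrable_stein_prod].
move=> n.
(* a j has mean zero by independence, r j is the Taylor remainder *)
pose Fn w := (\sum_(i < n) X i w) / s.
pose Fnj j w := (\sum_(i < n) (if i == j :> nat then 0 else X i w)) / s.
pose a j w := X j w * (level N n w * f (Fnj j w)).
pose r j w := level N n w * (X j w / s *
   (f (Fnj j w) - f (Fn w) + X j w / s * f' (Fn w))).
have FnE j w : (j < n)%N -> Fnj j w - Fn w = - (X j w / s).
  move=> jn; rewrite /Fnj /Fn -mulrBl -mulNr; congr (_ / _).
  rewrite -sumrB (bigD1 (Ordinal jn))//= eqxx sub0r big1 ?addr0// => i.
  by rewrite -val_eqE/= => /negbTE ->; rewrite subrr.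
have splitE w : level N n w * (f' (S w / s) * (S2 w / s ^+ 2) - S w / s * f (S w / s))
    = \sum_(j < n) (- s^-1 * a j w + r j w).
  rewrite (level_congr N n (fun n w =>
    f' ((\sum_(j < n) X j w) / s) * ((\sum_(j < n) X j w ^+ 2) / s ^+ 2) -
    (\sum_(j < n) X j w) / s * f ((\sum_(j < n) X j w) / s))) -/(Fn w).
  transitivity (\sum_(j < n) level N n w *
      (f' (Fn w) * (X j w ^+ 2 / s ^+ 2) - X j w / s * f (Fn w))).
    rewrite -mulr_sumr; congr (_ * _); rewrite sumrB; congr (_ - _).
      by rewrite -[RHS]mulr_sumr mulr_suml.
    by rewrite -[RHS]mulr_suml; congr (_ * _); rewrite /Fn mulr_suml.
  apply: eq_bigr => j _; rewrite /a /r; field.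
  exact: lt0r_neq0.
have mFnj j : (j < n)%N -> leave_one_out_measurable N X n j (Fnj j).
  move=> jn; apply: measurable_funM => //; apply: measurable_sum => i.
  case: (eqVneq (i : nat) j) => // ij.
  by apply: leave_one_out_X.
have ia j : (j < n)%N -> Rintegrable P (a j) /\ \int[P]_w a j w = 0.
  move=> jn; have [iXj Xj0] := identically_distributed idX j mid iX.
  have mV : leave_one_out_measurable N X n j (fun w => level N n w * f (Fnj j w)).
    apply: measurable_funM; first exact: leave_one_out_level.
    by apply: measurableT_comp => //; exact: mFnj.
  have iV : Rintegrable P (fun w => level N n w * f (Fnj j w)).
    apply: (@Rintegrable_bounded _ _ _ _ _ 1).
      exact: leave_one_out_measurable_fun mV.
    by move=> w; rewrite normrM mulr_ile1// level_norm_le1.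
  have := leave_one_out_indep indNX mid iXj mV iV.
  by rewrite Xj0 X_centered mul0r.
have mFn : measurable_fun setT Fn.
  by apply: measurable_funM => //; apply: measurable_sum => i.
have r_le j w : (j < n)%N -> `|r j w| <= s ^- 3 * (`|X j w| ^+ 3 * level N n w).
  move=> jn; rewrite /r normrM ger0_norm ?level_ge0//.
  rewrite [leRHS](_ : _ = level N n w * (`|X j w / s| * `|X j w / s| ^+ 2)).
    rewrite ler_wpM2l ?level_ge0// normrM ler_wpM2l//.
    have := f_taylor (Fn w) (Fnj j w); rewrite FnE// sqrrN mulNr opprK.
    by rewrite real_normK ?num_real.
  rewrite normrM (@ger0_norm _ s^-1) ?invr_ge0 ?(ltW s0)//; field.
  exact: lt0r_neq0.
have ir j : (j < n)%N -> Rintegrable P (r j) /\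
    `|\int[P]_w r j w| <= m3 / s ^+ 3 * \int[P]_w level N n w.
  move=> jn.
  have [iX3j X3j] := level_moment indNX idX n j mcube iX3.
  have irj : Rintegrable P (r j).
    apply: (@Rintegrable_le _ _ _ _ _ (fun w => s ^- 3 * (`|X j w| ^+ 3 * level N n w))).
    - have mFj := leave_one_out_measurable_fun (mFnj j jn).
      apply: measurable_funM; first exact: measurable_level.
      apply: measurable_funM; first exact: measurable_funM.
      apply: measurable_funD.
        by apply: measurable_funB; exact: measurableT_comp.
      apply: measurable_funM; first exact: measurable_funM.
      exact: measurableT_comp.
    - by move=> w; exact: r_le.
    - exact: RintegrableZ.
  split=> //; apply: (le_trans (Rintegral_norm_le irj)).
  rewrite (mulrC m3) -mulrA -X3j -RintegralZl//.
  apply: Rintegral_le.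
  - exact: Rintegrable_norm.
  - exact: RintegrableZ.
  - by move=> w; exact: r_le.
have iar j : (j < n)%N -> Rintegrable P (fun w => - s^-1 * a j w + r j w).
  move=> jn; apply: RintegrableD; last by case: (ir j jn).
  by apply: RintegrableZ; case: (ia j jn).
under eq_Rintegral do rewrite splitE.
rewrite (@Rintegral_sum _ _ _ P n (fun j w => - s^-1 * a j w + r j w))//.
apply: (le_trans (ler_norm_sum _ _ _)).
rewrite [leRHS]mulrCA mulr_natl -[in leRHS](card_ord n) -sumr_const.
apply: ler_sum => j _.
have [iaj aj] := ia j (ltn_ord j); have [irj rj] := ir j (ltn_ord j).
rewrite RintegralD//; last exact: RintegrableZ.
by rewrite RintegralZl// aj mulr0 add0r card_ord.
Qed.

End SteinRandomSum.

(** * The normal approximation *)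

Section Distance.
Context d (T : measurableType d) (R : realType) (P : probability T R).
Context (N : {RV P >-> nat}) (X : nat -> {RV P >-> R}).
Hypothesis indNX : mutually_independent P (sigma_N_X N X).
Hypothesis idX : forall (j : nat) (A : set R), measurable A ->
  distribution P (X j) A = distribution P (X 0%N) A.
Hypothesis iN : Rintegrable P (fun w => (N w)%:R).
Hypothesis iN2 : Rintegrable P (fun w => (N w)%:R ^+ 2).
Let EN := \int[P]_w (N w)%:R.
Let VN := \int[P]_w ((N w)%:R - EN) ^+ 2.
Hypothesis EN0 : 0 < EN.
Hypothesis iX : Rintegrable P (X 0%N).
Hypothesis iX2 : Rintegrable P (fun w => X 0%N w ^+ 2).
Hypothesis iX3 : Rintegrable P (fun w => `|X 0%N w| ^+ 3).
Hypothesis iX4 : Rintegrable P (fun w => X 0%N w ^+ 4).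
Hypothesis X_centered : \int[P]_w X 0%N w = 0.
Let m2 := \int[P]_w X 0%N w ^+ 2.
Let m3 := \int[P]_w `|X 0%N w| ^+ 3.
Let m4 := \int[P]_w X 0%N w ^+ 4.
Hypothesis m20 : 0 < m2.

Let S := random_sum N X.
Let S2 := random_sum N (fun j w => X j w ^+ 2).
Let s := Num.sqrt (EN * m2).

Let s0 : 0 < s. Proof. by rewrite sqrtr_gt0 mulr_gt0. Qed.

Let sqr_s : s ^+ 2 = EN * m2.
Proof. by rewrite sqr_sqrtr// mulr_ge0// ltW. Qed.

Let msqr : measurable_fun setT (fun x : R => x ^+ 2).
Proof. exact: measurable_funX. Qed.

Let iS2 : Rintegrable P S2.
Proof. by have [] := wald1 indNX idX iN msqr iX2. Qed.

(** The normalised deviation of one square: [1 - S2 / s ^+ 2] is [EN^-1] times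
    the sum of [EN - N] and of the random sum with terms [v (X j)]. *)
Let v (x : R) := 1 - x ^+ 2 / m2.

Let mv : measurable_fun setT v.
Proof. by apply: measurable_funB => //; exact: measurable_funM. Qed.

Let iv : Rintegrable P (v \o X 0%N).
Proof.
apply: RintegrableB; first exact: Rintegrable_cst.
under [X in Rintegrable _ X]eq_fun do rewrite mulrC.
exact: RintegrableZ.
Qed.

Let v_centered : \int[P]_w v (X 0%N w) = 0.
Proof.
rewrite /v; under eq_Rintegral do rewrite mulrC.
rewrite RintegralB//; [|exact: Rintegrable_cst|exact: RintegrableZ].
by rewrite Rintegral_prob_cst RintegralZl// mulVf ?subrr// gt_eqF.
Qed.

Let v2E : (fun w => v (X 0%N w) ^+ 2) =
  (fun w => (1 - 2 / m2 * X 0%N w ^+ 2) + m2 ^- 2 * X 0%N w ^+ 4).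
Proof. by apply/funext => w; rewrite /v; field; rewrite gt_eqF. Qed.

Let iv2 : Rintegrable P (fun w => v (X 0%N w) ^+ 2).
Proof.
rewrite v2E; apply: RintegrableD; last exact: RintegrableZ.
by apply: RintegrableB; [exact: Rintegrable_cst|exact: RintegrableZ].
Qed.

Let v2_mean : \int[P]_w v (X 0%N w) ^+ 2 = m4 / m2 ^+ 2 - 1.
Proof.
rewrite v2E RintegralD//; last 2 first.
- by apply: RintegrableB; [exact: Rintegrable_cst|exact: RintegrableZ].
- exact: RintegrableZ.
rewrite RintegralB//; [|exact: Rintegrable_cst|exact: RintegrableZ].
rewrite Rintegral_prob_cst !RintegralZl// -/m2 -/m4; field.
by rewrite gt_eqF.
Qed.

Lemma fourth_moment_ge : 0 <= m4 / m2 ^+ 2 - 1.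
Proof. by rewrite -v2_mean; apply: Rintegral_ge0 => w _; exact: sqr_ge0. Qed.

Let norm_deviation :
  \int[P]_w `|1 - S2 w / s ^+ 2| <=
  Num.sqrt VN / EN + Num.sqrt (EN * (m4 / m2 ^+ 2 - 1)) / EN.
Proof.
have EN_neq0 : EN != 0 by rewrite gt_eqF.
have m2_neq0 : m2 != 0 by rewrite gt_eqF.
have [iSv2 Sv2] := wald2 indNX idX iN mv iv iv2 v_centered.
have [iSv _] := wald1 indNX idX iN mv iv.
set Sv := random_sum N (fun j w => v (X j w)) in iSv2 Sv2 iSv.
have iD : Rintegrable P (fun w => EN - (N w)%:R).
  by apply: RintegrableB => //; exact: Rintegrable_cst.
have D2E : (fun w => (EN - (N w)%:R) ^+ 2) = (fun w => ((N w)%:R - EN) ^+ 2).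
  by apply/funext => w; rewrite -sqrrN opprB.
have iD2 : Rintegrable P (fun w => (EN - (N w)%:R) ^+ 2).
  have -> : (fun w => (EN - (N w)%:R) ^+ 2) =
      (fun w => (EN ^+ 2 - 2 * EN * (N w)%:R) + (N w)%:R ^+ 2).
    by apply/funext => w; ring.
  apply: RintegrableD => //; apply: RintegrableB; first exact: Rintegrable_cst.
  exact: RintegrableZ.
have decomp w : 1 - S2 w / s ^+ 2 = EN^-1 * (EN - (N w)%:R) + EN^-1 * Sv w.
  have -> : Sv w = (N w)%:R - S2 w / m2.
    rewrite /Sv /S2 /random_sum /v sumrB sumr_const card_ord; congr (_ - _).
    by rewrite mulr_suml.
  by rewrite sqr_s; field; rewrite EN_neq0 m2_neq0.
apply: (@le_trans _ _ (EN^-1 * \int[P]_w `|EN - (N w)%:R| + EN^-1 * \int[P]_w `|Sv w|)).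
  have iA := RintegrableZ EN^-1 (Rintegrable_norm iD).
  have iB := RintegrableZ EN^-1 (Rintegrable_norm iSv).
  rewrite -!RintegralZl//; [|exact: Rintegrable_norm|exact: Rintegrable_norm].
  rewrite -RintegralD//; apply: Rintegral_le.
  - apply: Rintegrable_norm; apply: RintegrableB; first exact: Rintegrable_cst.
    under [X in Rintegrable _ X]eq_fun do rewrite mulrC.
    exact: RintegrableZ.
  - exact: RintegrableD.
  - move=> w; rewrite decomp (le_trans (ler_normD _ _))//.
    by rewrite !normrM ger0_norm// invr_ge0 ltW.
rewrite ![EN^-1 * _]mulrC lerD// ler_wpM2r ?invr_ge0 ?(ltW EN0)//.
- apply: (le_trans (Rintegral_norm_le_sqrt iD2 iD)).
  by rewrite D2E.
- apply: (le_trans (Rintegral_norm_le_sqrt iSv2 iSv)).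
  by rewrite Sv2 v2_mean mulrC.
Qed.

(** By Stein's equation [h (F) - E h(Z)] is [f' (F) - F * f (F)] with
    [F = S / s]. Insert [f' (F) * S2 / s ^+ 2]: the bound on [f'] and the
    deviation of [S2 / s ^+ 2] from 1 control one difference, the leave-one-out
    argument the other. *)
Lemma random_sum_normal_approx (h : R -> R) :
  (forall x y, `|h x - h y| <= `|x - y|) ->
  Rintegrable P (fun w => h (S w / s)) /\
  `|\int[P]_w h (S w / s) - gauss_mean h| <=
    2 * normal_pdf 0 1 0 *
      (Num.sqrt VN / EN + Num.sqrt (EN * (m4 / m2 ^+ 2 - 1)) / EN)
    + m3 / s ^+ 3 * EN.
Proof.
move=> hlip; pose f := stein h; pose f' := stein' h; set c := 2 * normal_pdf 0 1 0.
have cf : continuous f.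
  by move=> x; apply: derivable1_cvg; have [] := is_derive_stein hlip x.
have ch := lipschitz_continuous hlip.
have mh : measurable_fun setT h by exact: continuous_measurable_fun.
have mf : measurable_fun setT f by exact: continuous_measurable_fun.
have mf' : measurable_fun setT f'.
  apply: measurable_funD; first exact: measurable_funM.
  exact: measurable_funB.
have f1 x : `|f x| <= 1 by exact: stein_le1.
have f'c x : `|f' x| <= c by exact: stein'_le.
have ft x y : `|f y - f x - (y - x) * f' x| <= (y - x) ^+ 2 by exact: stein_taylor.
have mid : measurable_fun setT (@id R) by exact: measurable_id.
have [iS _] := wald1 indNX idX iN mid iX.
have mF : measurable_fun setT (fun w => S w / s).
  by apply: measurable_funM => //; exact: Rintegrable_measurable iS.
have ihF : Rintegrable P (fun w => h (S w / s)).
  apply: (@Rintegrable_le _ _ _ _ _ (fun w => `|h 0| + s^-1 * `|S w|)).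
  - exact: measurableT_comp.
  - move=> w; rewrite -[h (S w / s)](subrK (h 0)) addrC.
    rewrite (le_trans (ler_normD _ _))// lerD2l (le_trans (hlip _ _))// subr0.
    by rewrite normrM mulrC ger0_norm// invr_ge0 (ltW s0).
  - apply: RintegrableD; first exact: Rintegrable_cst.
    exact: RintegrableZ (Rintegrable_norm iS).
split=> //.
have i1 := Rintegrable_stein_main indNX idX iN iX2 s mf' f'c.
have i2 := Rintegrable_stein_prod indNX idX iN iX s0 mf f1.
have := stein_random_sum indNX idX iN iX iX2 iX3 X_centered s0 mf mf' f1 f'c ft.
rewrite -/S -/S2 -/m3 -/EN => main.
have if' : Rintegrable P (fun w => f' (S w / s)).
  by apply: (@Rintegrable_bounded _ _ _ _ _ c) => //; exact: measurableT_comp.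
have i3 : Rintegrable P (fun w => f' (S w / s) * (1 - S2 w / s ^+ 2)).
  have -> : (fun w => f' (S w / s) * (1 - S2 w / s ^+ 2)) =
      (fun w => f' (S w / s) - f' (S w / s) * (S2 w / s ^+ 2)).
    by apply/funext => w; ring.
  exact: RintegrableB.
have steinE w : h (S w / s) = gauss_mean h +
    (f' (S w / s) * (1 - S2 w / s ^+ 2) +
     (f' (S w / s) * (S2 w / s ^+ 2) - S w / s * f (S w / s))).
  by rewrite /f' /stein' /f; ring.
under eq_Rintegral do rewrite steinE.
rewrite RintegralD//; last 2 first.
- exact: Rintegrable_cst.
- by apply: RintegrableD => //; exact: RintegrableB.
rewrite Rintegral_prob_cst [gauss_mean h + _]addrC addrK.
rewrite RintegralD//; last exact: RintegrableB.
apply: (le_trans (ler_normD _ _)); rewrite lerD//.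
apply: (le_trans (Rintegral_norm_le i3)).
have c0 : 0 <= c by rewrite mulr_ge0// normal_pdf_ge0.
apply: le_trans (ler_wpM2l c0 norm_deviation).
have iQ : Rintegrable P (fun w => `|1 - S2 w / s ^+ 2|).
  apply: Rintegrable_norm; apply: RintegrableB; first exact: Rintegrable_cst.
  under [X in Rintegrable _ X]eq_fun do rewrite mulrC.
  exact: RintegrableZ.
rewrite -RintegralZl//; apply: Rintegral_le.
- exact: Rintegrable_norm.
- exact: RintegrableZ.
- by move=> w; rewrite normrM ler_wpM2r.
Qed.

End Distance.

Section BoundAlgebra.
Context {R : realType}.

(** The term with [VN] keeps a factor [sqrt (2 / pi)], which is at most 1 as
    [2 <= pi]. *)
Lemma bound_algebra (EN VN m2 m3 m4 : R) : 0 < EN -> 0 < m2 -> 0 <= m3 ->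
  0 <= m4 / m2 ^+ 2 - 1 ->
  2 * normal_pdf 0 1 0 *
      (Num.sqrt VN / EN + Num.sqrt (EN * (m4 / m2 ^+ 2 - 1)) / EN)
    + m3 / Num.sqrt (EN * m2) ^+ 3 * EN <=
  (Num.sqrt (2 / pi) * (m4 / m2 ^+ 2 - 1) `^ (1 / 2) + m3 / m2 `^ (3 / 2)) *
    (1 / Num.sqrt EN) + Num.sqrt VN / EN.
Proof.
move=> EN0 m20 m30 b0; rewrite two_phi0.
have c1 : Num.sqrt (2 / pi) <= 1 :> R.
  rewrite -[leRHS]sqrtr1 ler_sqrt// ler_pdivrMr ?pi_gt0// mul1r.
  exact: pi_ge2.
have c0 : 0 <= Num.sqrt (2 / pi) :> R by exact: sqrtr_ge0.
rewrite [1 / 2]mul1r powR12_sqrt//.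
have -> : m2 `^ (3 / 2) = Num.sqrt m2 ^+ 3.
  by rewrite [3 / 2]mulrC powRrM powR12_sqrt ?(ltW m20)// powR_mulrn.
move: (Num.sqrt (2 / pi)) c0 c1 => c c0 c1.
rewrite !sqrtrM ?(ltW EN0)//.
have : 0 < Num.sqrt EN by rewrite sqrtr_gt0.
have : 0 < Num.sqrt m2 by rewrite sqrtr_gt0.
have : 0 <= Num.sqrt VN / EN by rewrite divr_ge0// ltW.
have : EN = Num.sqrt EN ^+ 2 by rewrite sqr_sqrtr// ltW.
move: (Num.sqrt VN / EN) (Num.sqrt (_ - 1)) (Num.sqrt EN) (Num.sqrt m2).
move=> q beta a b -> q0 pb pa.
have an0 : a != 0 by rewrite gt_eqF.
have bn0 : b != 0 by rewrite gt_eqF.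
rewrite -subr_ge0 (_ : _ - _ = (1 - c) * q); first by rewrite mulr_ge0// subr_ge0.
by field; rewrite an0 bn0.
Qed.

End BoundAlgebra.

Section Bridge.
Context d (T : measurableType d) (R : realType) (P : probability T R).

Lemma fine_expectation (f : T -> R) : fine 'E_P[f]%E = \int[P]_w f w.
Proof. by rewrite unlock. Qed.

Lemma Rintegrable_ge0 (f : T -> R) : measurable_fun setT f ->
  (forall w, 0 <= f w) -> ('E_P[f] < +oo)%E -> Rintegrable P f.
Proof.
move=> mf f0; rewrite unlock => foo.
apply/integrableP; split; first exact/measurable_EFinP.
by under eq_integral do rewrite /= ger0_norm//.
Qed.

Lemma fine_variance (f : T -> R) :
  fine 'V_P[f]%E = \int[P]_w (f w - \int[P]_w f w) ^+ 2.
Proof.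
by rewrite /variance unlock !fine_expectation.
Qed.

(** If the second moment vanished, [f] would be zero almost everywhere. *)
Lemma Rintegral_sqr_gt0 (f : T -> R) : measurable_fun setT f ->
  Rintegrable P (fun w => f w ^+ 2) ->
  (0 < 'E_P[(fun w => f w ^+ 4)%R])%E -> 0 < \int[P]_w f w ^+ 2.
Proof.
move=> mf if2 f4; rewrite ltNge; apply/negP => f2.
have mf2 : measurable_fun setT (fun w => (f w ^+ 2)%:E).
  by apply/measurable_EFinP; exact: measurable_funX.
have f20 : (\int[P]_w `|(f w ^+ 2)%:E| = 0)%E.
  under eq_integral do rewrite gee0_abs ?lee_fin ?sqr_ge0//.
  rewrite -[LHS]fineK; last exact: integrable_fin_num if2.
  congr EFin; apply/eqP; rewrite eq_le f2/=.
  by apply: Rintegral_ge0 => w _; exact: sqr_ge0.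
move/(ae_eq_integral_abs P measurableT mf2) : f20 => f20.
suff f40 : (\int[P]_w (f w ^+ 4)%:E = 0)%E by move: f4; rewrite unlock f40 ltxx.
rewrite -[RHS](integral0 P setT); apply: ae_eq_integral => //.
  by apply/measurable_EFinP; exact: measurable_funX.
apply: filterS f20 => w /= /(_ Logic.I) [/eqP]; rewrite sqrf_eq0 => /eqP -> _.
by rewrite expr0n.
Qed.

End Bridge.

Lemma norm_exp_le (R : realDomainType) (x : R) k : (k <= 4)%N ->
  `|x| ^+ k <= 1 + x ^+ 4.
Proof.
move=> k4; have -> : x ^+ 4 = `|x| ^+ 4 by rewrite -normrX ger0_norm// exprn_even_ge0.
have [x1|x1] := leP `|x| 1.
  by rewrite (le_trans (exprn_ile1 k (normr_ge0 x) x1))// lerDl exprn_ge0.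
by rewrite (le_trans (ler_weXn2l (ltW x1) k4))// lerDr.
Qed.

Theorem theorem1p4 (R : realType)
    (d : measure_display) (T : measurableType d) (P : probability T R)
    (N : {RV P >-> nat}) (X : nat -> {RV P >-> R})
    (d' : measure_display) (T' : measurableType d') (Q : probability T' R)
    (Z : {RV Q >-> R}) :
  mutually_independent P (sigma_N_X N X) ->
  (0 < 'E_P[(fun w => (N w)%:R)%R])%E ->
  ('E_P[(fun w => (N w)%:R ^+ 2)%R] < +oo)%E ->
  (forall (j : nat) (A : set R), measurable A ->
     distribution P (X j) A = distribution P (X 0%N) A) ->
  ('E_P[X 0%N] = 0)%E ->
  (0 < 'E_P[(fun w => X 0%N w ^+ 4)%R])%E ->
  ('E_P[(fun w => X 0%N w ^+ 4)%R] < +oo)%E ->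
  (forall A : set R, measurable A ->
     distribution Q Z A = normal_prob 0 1 A) ->
  let EN := fine 'E_P[(fun w => (N w)%:R)%R] in
  let VN := fine 'V_P[(fun w => (N w)%:R)%R] in
  let m2 := fine 'E_P[(fun w => X 0%N w ^+ 2)%R] in
  let m3 := fine 'E_P[(fun w => `|X 0%N w| ^+ 3)%R] in
  let m4 := fine 'E_P[(fun w => X 0%N w ^+ 4)%R] in
  let S := random_sum N X in
  let F := standardize P S in
  [/\ forall w, (fun n : nat => \sum_(0 <= j < n)
        \1_[set w' | (j < N w')%N] w * X j w) @ \oo --> S w,
      forall w, F w = S w / Num.sqrt (EN * m2)
    & (wasserstein P F Q Z <=
       ((Num.sqrt (2 / pi) * (m4 / m2 ^+ 2 - 1) `^ (1 / 2)
           + m3 / m2 `^ (3 / 2)) * (1 / Num.sqrt EN)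
        + Num.sqrt VN / EN)%:E)%E].
Proof.
move=> indNX EN_gt0 EN2 idX EX0 EX4_gt0 EX4 QZ EN VN m2 m3 m4 S F.
have mX : measurable_fun setT (X 0%N) by exact: measurable_funPT.
have mN : measurable_fun setT (fun w => (N w)%:R : R).
  apply: (@measurable_levelwise _ _ _ P N) => n.
  under eq_fun do rewrite (level_congr N n (fun k _ => k%:R)) mulrC.
  by apply: measurable_funM => //; exact: measurable_level.
have iN2 : Rintegrable P (fun w => (N w)%:R ^+ 2).
  by apply: Rintegrable_ge0 => //; exact: measurable_funX.
have iN : Rintegrable P (fun w => (N w)%:R).
  apply: (Rintegrable_le mN _ iN2) => w; rewrite normr_nat -natrX ler_nat.
  by case: (N w) => // n; rewrite -{1}(expn1 n.+1) leq_pexp2l.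
have iX4 : Rintegrable P (fun w => X 0%N w ^+ 4).
  apply: Rintegrable_ge0 => //; first exact: measurable_funX.
  by move=> w; exact: exprn_even_ge0.
have iX41 : Rintegrable P (fun w => 1 + X 0%N w ^+ 4).
  by apply: RintegrableD => //; exact: Rintegrable_cst.
have iX : Rintegrable P (X 0%N).
  by apply: (Rintegrable_le mX _ iX41) => w; exact: (@norm_exp_le _ _ 1).
have iX2 : Rintegrable P (fun w => X 0%N w ^+ 2).
  apply: (Rintegrable_le _ _ iX41); first exact: measurable_funX.
  by move=> w; rewrite normrX; exact: norm_exp_le.
have iX3 : Rintegrable P (fun w => `|X 0%N w| ^+ 3).
  apply: (Rintegrable_le _ _ iX41).
    by apply: measurable_funX; exact: measurableT_comp.
  by move=> w; rewrite ger0_norm ?exprn_ge0//; exact: norm_exp_le.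
have ENE : EN = \int[P]_w (N w)%:R by exact: fine_expectation.
have m2E : m2 = \int[P]_w X 0%N w ^+ 2 by exact: fine_expectation.
have m3E : m3 = \int[P]_w `|X 0%N w| ^+ 3 by exact: fine_expectation.
have m4E : m4 = \int[P]_w X 0%N w ^+ 4 by exact: fine_expectation.
have X_centered : \int[P]_w X 0%N w = 0 by rewrite -fine_expectation EX0.
have EN0 : 0 < EN.
  rewrite fine_gt0// EN_gt0/= unlock -ge0_fin_numE ?integral_ge0//.
  exact: integrable_fin_num iN.
have m20 : 0 < m2 by rewrite m2E; exact: Rintegral_sqr_gt0.
have mid : measurable_fun setT (@id R) by exact: measurable_id.
have [iS ES] := wald1 indNX idX iN mid iX.
have [iS2 ES2] := wald2 indNX idX iN mid iX iX2 X_centered.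
have FE w : F w = S w / Num.sqrt (EN * m2).
  rewrite /F /standardize fine_variance fine_expectation ES X_centered mul0r.
  rewrite subr0; congr (_ / Num.sqrt _).
  under eq_Rintegral do rewrite subr0.
  by rewrite ES2 ENE m2E mulrC.
split=> //.
- move=> w; apply: cvg_near_cst; near=> n.
  have Nn : (N w <= n)%N by near: n; exact: nbhs_infty_ge.
  rewrite /S /random_sum big_mkord (big_ord_widen n (fun j => X j w) Nn).
  rewrite [RHS]big_mkcond/=.
  apply: eq_bigr => j _; rewrite indicE.
  case: ifPn => jN; first by rewrite mem_set// mul1r.
  by rewrite memNset ?mul0r//; apply/negP.
- apply: ge_ereal_sup => _ [h hlip1 <-].
  have hlip x y : `|h x - h y| <= `|x - y|.
    by have := hlip1 (x, y) (conj Logic.I Logic.I); rewrite /= mul1r.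
  rewrite (expectation_lipschitz_normal hlip QZ).
  rewrite m2E in m20; have EN0' := EN0; rewrite ENE in EN0'.
  have [ihF hF] := random_sum_normal_approx indNX idX iN iN2 EN0'
    iX iX2 iX3 iX4 X_centered m20 hlip.
  have -> : 'E_P[h \o F]%E = (\int[P]_w h (S w / Num.sqrt (EN * m2)))%:E.
    rewrite unlock -[LHS]fineK.
      by congr (fine _)%:E; apply: eq_integral => w _; rewrite /= FE.
    apply: integrable_fin_num => //; apply: eq_integrable ihF => // w _ /=.
    by rewrite FE ENE m2E.
  rewrite -EFinB abse_EFin lee_fin.
  have VNE : VN = \int[P]_w ((N w)%:R - EN) ^+ 2.
    by rewrite /VN fine_variance ENE.
  have b0 : 0 <= m4 / m2 ^+ 2 - 1.
    by rewrite m2E m4E; exact: (fourth_moment_ge iX2 iX4).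
  apply: le_trans (bound_algebra VN EN0 _ _ b0); last 2 first.
  - by rewrite m2E.
  - by rewrite m3E; apply: Rintegral_ge0 => w _; rewrite exprn_ge0.
  by rewrite VNE m2E m3E m4E ENE.
Unshelve. all: by end_near.
Qed.
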